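(* Let $0<q<1$, let $a,b$ be real with $0<a<q^{-1}$ and $b<q^{-1}$, and let $v\in\mathbb{C}$. Let $(P_n)_{n\ge0}$ be the monic matrix-valued orthogonal polynomials with respect to $\langle\cdot,\cdot\rangle_W$ with weight matrix $$W(q^x)=a^x\frac{(bq;q)_x}{(q;q)_x}A^x(A^* )^x,\quad x\in\mathbb{N},\qquad A=\begin{pmatrix}q&-v(1-q)\\0&1\end{pmatrix},$$ let $\tilde P_n=N_nP_n$ and $H_n=\langle\tilde P_n,\tilde P_n\rangle_W$. Then, for all $n\ge0$, $\tilde P_n(0)$ is given by $$\tilde P_n(0)=\begin{pmatrix}\kappa_{11}^n&\kappa_{12}^n+\kappa_{11}^nv\\\kappa_{21}^n&\kappa_{22}^n+\kappa_{21}^nv\end{pmatrix},\qquad\det\tilde P_n(0)=\kappa_{11}^n\kappa_{22}^n-\kappa_{21}^n\kappa_{12}^n>0,$$ and the three-term recurrence relation $$z\tilde P_n(z)=A_n\tilde P_{n+1}(z)+B_n\tilde P_n(z)+C_n\tilde P_{n-1}(z)$$ holds with $$A_n=N_nN_{n+1}^{-1}=\begin{pmatrix}1&-\dfrac{q^n(1-q)(1-aq)(1+abq^{2n+3})}{(1-abq^{2n+2})(1-abq^{2n+4})}v\\0&1\end{pmatrix},$$ $$C_n=H_nA_{n-1}^*H_{n-1}^{-1},$$ $$B_n=-A_n\tilde P_{n+1}(0)\tilde P_n(0)^{-1}-C_n\tilde P_{n-1}(0)\tilde P_n(0)^{-1},$$ where for $n=0$ the terms containing $C_0$ are absent.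
   Context: $\mathbb{N}=\{0,1,2,\dots\}$; $(c;q)_n=\prod_{i=0}^{n-1}(1-cq^i)$. The inner product is $\langle P,Q\rangle_W=\sum_{x=0}^\infty q^xP(q^x)W(q^x)Q(q^x)^*$ on polynomials with coefficients in $\mathrm{Mat}_2(\mathbb{C})$; the monic orthogonal polynomials are the unique sequence $(P_n)$ with $P_n$ of degree $n$, leading coefficient $I$, and $\langle P_m,P_n\rangle_W=0$ for $m\ne n$. Further $$N_n=\begin{pmatrix}1&\alpha_n\\0&1\end{pmatrix},\quad\alpha_n=v\,\frac{1-q^n+aq^{n+1}-abq^{2n+2}}{1-abq^{2n+2}},$$ $$\kappa_{11}^n=(-1)^nq^{\binom n2}\frac{(aq^3;q)_n}{(abq^{n+3};q)_n},\qquad \kappa_{12}^n=(-1)^{n+1}v\,q^{\binom{n+1}2}\frac{(aq;q)_{n+1}}{(abq^{n+2};q)_{n+1}},$$ $$\kappa_{21}^n=(-1)^n\xi_n\,a\overline{v}\,q^{\binom n2-n+2}\frac{(1-q^n)(1-bq^n)}{(1-aq)(1-aq^2)}\frac{(aq;q)_n}{(abq^{n+1};q)_n},\qquad \kappa_{22}^n=(-1)^n\xi_n\,q^{\binom n2}\frac{(aq;q)_n}{(abq^{n+1};q)_n},$$ $$\xi_n=\left(1+aq|v|^2\frac{(1-q^n)(1-bq^n)}{(1-abq^{n+1})(1-aq^{n+1})}\right)^{-1}.$$ *)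

(* Defs.v *)
(* Complex numbers are R[i] (mathcomp-real-closed) over R : realType. *)
From mathcomp Require Export all_boot all_order all_algebra complex.
From mathcomp Require Export all_classical all_reals all_analysis.

Set Implicit Arguments.
Unset Strict Implicit.
Unset Printing Implicit Defensive.

Export Order.TTheory GRing.Theory Num.Theory.
Export numFieldNormedType.Exports.

#[export] Set Warnings "-notation-overridden,-ambiguous-paths".

Local Open Scope ring_scope.
Local Open Scope complex_scope.
Local Open Scope sesquilinear_scope.

Definition qpoch (R : realType) (c q : R) (n : nat) : R :=
  \prod_(i < n) (1 - c * q ^+ i).

Definition mx2 (K : Type) (a b c d : K) : 'M[K]_2 :=
  \matrix_(i, j) if i == ord0 then (if j == ord0 then a else b)
                 else (if j == ord0 then c else d).

(* Value at the complex number z of a polynomial with matrix coefficients; the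
   scalar matrix z%:M is central, so left and right evaluation agree. *)
Definition mxeval (R : realType) (P : {poly 'M[R[i]]_2}) (z : R[i]) :
  'M[R[i]]_2 := P.[z%:M].

(* <P, Q>_W, the series being summed entrywise.  A weight on the q-lattice is
   given by its values: W x is the weight at the point q ^+ x. *)
Definition inner (R : realType) (q : R) (W : nat -> 'M[R[i]]_2)
    (P Q : {poly 'M[R[i]]_2}) : 'M[R[i]]_2 :=
  \matrix_(i, j) limn (series (fun x : nat =>
    ((q ^+ x)%:C *: (mxeval P (q ^+ x)%:C *m W x
                     *m (mxeval Q (q ^+ x)%:C) ^t* )) i j : R[i]^o)).

Definition monic_orthogonal (R : realType) (q : R) (W : nat -> 'M[R[i]]_2)
    (P : nat -> {poly 'M[R[i]]_2}) : Prop :=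
  (forall n, size (P n) = n.+1 /\ P n \is monic) /\
  (forall m n, m <> n -> inner q W (P m) (P n) = 0).

Definition weight (R : realType) (q a b : R) (v : R[i]) (x : nat) :
    'M[R[i]]_2 :=
  let A := mx2 q%:C (- (v * (1 - q)%:C)) 0 1 in
  (a ^+ x * (qpoch (b * q) q x / qpoch q q x))%:C *: (A ^+ x *m (A ^t* ) ^+ x).

Definition alpha (R : realType) (q a b : R) (v : R[i]) (n : nat) : R[i] :=
  v * ((1 - q ^+ n + a * q ^+ n.+1 - a * b * q ^+ (2 * n + 2))
       / (1 - a * b * q ^+ (2 * n + 2)))%:C.

Definition Nmx (R : realType) (q a b : R) (v : R[i]) (n : nat) : 'M[R[i]]_2 :=
  mx2 1 (alpha q a b v n) 0 1.

(* When n = 0 the factor 1 - a * b * q may vanish; the numerator 1 - q ^+ 0 is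
   then 0 and x / 0 = 0 is consistent with xi_0 = 1. *)
Definition xi (R : realType) (q a b : R) (v : R[i]) (n : nat) : R[i] :=
  (1 + (a * q)%:C * `|v| ^+ 2 *
       ((1 - q ^+ n) * (1 - b * q ^+ n)
        / ((1 - a * b * q ^+ n.+1) * (1 - a * q ^+ n.+1)))%:C)^-1.

Definition kappa11 (R : realType) (q a b : R) (n : nat) : R[i] :=
  ((-1) ^+ n * q ^+ 'C(n, 2)
   * (qpoch (a * q ^+ 3) q n / qpoch (a * b * q ^+ (n + 3)) q n))%:C.

Definition kappa12 (R : realType) (q a b : R) (v : R[i]) (n : nat) : R[i] :=
  v * ((-1) ^+ n.+1 * q ^+ 'C(n.+1, 2)
       * (qpoch (a * q) q n.+1 / qpoch (a * b * q ^+ (n + 2)) q n.+1))%:C.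

(* The exponent binom(n,2) - n + 2 is always positive; adding 2 first keeps the
   truncated subtraction on nat exact. *)
Definition kappa21 (R : realType) (q a b : R) (v : R[i]) (n : nat) : R[i] :=
  xi q a b v n * v^* *
  ((-1) ^+ n * a * q ^+ ('C(n, 2) + 2 - n)
   * ((1 - q ^+ n) * (1 - b * q ^+ n) / ((1 - a * q) * (1 - a * q ^+ 2)))
   * (qpoch (a * q) q n / qpoch (a * b * q ^+ n.+1) q n))%:C.

Definition kappa22 (R : realType) (q a b : R) (v : R[i]) (n : nat) : R[i] :=
  xi q a b v n *
  ((-1) ^+ n * q ^+ 'C(n, 2)
   * (qpoch (a * q) q n / qpoch (a * b * q ^+ n.+1) q n))%:C.

(* Main.v *)
Require Import Defs.
From mathcomp Require Import ring lra zify.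

(** At z = q^x the power A^x has entries that are polynomials in z, so a row (p1, p2) of a
    matrix polynomial turns P(z) A^x into the row (f, g) with f = z p1 and
    g = p2 - v (1 - z) p1, and the inner product becomes L(f conj F) + L(g conj G)
    for two such rows (f, g) and (F, G), with L the scalar little q-Jacobi functional of
    parameters a, b ([innerE]).

    In these terms the orthogonality conditions decouple.  Write p_n for the monic little
    q-Jacobi polynomials with parameters a, b and r_n for those with parameters a q^2, b,
    which are orthogonal for the weight multiplied by z^2.  The first row of the normalised
    polynomial is f = z r_n, g = v p_(n+1).  The second is f = c z r_(n-1), g = xi p_n, where
    c and xi are fixed by orthogonality to the vector (z^n, v z^n) and by the leading
    coefficient; these two equations involve only the ratio of the norms of p_n and r_(n-1),
    which is the fraction inside xi ([lqj_norm_rec]).  At z = 0 the entry p1 is the linear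
    coefficient of f and p2 is g(0) + v p1(0), so the four kappa come from the explicit
    constant terms of the scalar polynomials ([lqj_coef0]).

    The scalar facts are algebraic consequences of the two-term recurrence of the moments
    ([moment_lqj]): orthogonality from the symmetry of the q-difference operator of which
    p_n is an eigenfunction, the norm ratio from a contiguous relation ([lqj_connection]).

    Invertible norms make a sequence of orthogonal polynomials with prescribed leading
    coefficients unique ([ortho_unique]) and give the three-term recurrence with the stated
    A_n and C_n and some middle coefficient ([ortho_recurrence]); evaluating at z = 0, where
    the determinant is positive, determines the middle coefficient. *)

Set Implicit Arguments.
Unset Strict Implicit.
Unset Printing Implicit Defensive.

Local Open Scope ring_scope.
Local Open Scope complex_scope.
Local Open Scope sesquilinear_scope.

(** * Linear functionals given by moments *)

Section MomentFunctional.
Variable F : comNzRingType.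
Implicit Types (m : nat -> F) (f g : {poly F}).

(** The functional sending the k-th power of the variable to [m k]. *)
Definition mfun m f : F := \sum_(k < size f) f`_k * m k.

Lemma mfun_widen m f n : (size f <= n)%N ->
  mfun m f = \sum_(k < n) f`_k * m k.
Proof.
move=> sfn; rewrite /mfun (big_ord_widen n (fun k => f`_k * m k)) //.
rewrite big_mkcond /=; apply: eq_bigr => k _; case: ltnP => // /leq_sizeP -> //.
by rewrite mul0r.
Qed.

Lemma mfunD m f g : mfun m (f + g) = mfun m f + mfun m g.
Proof.
set n := maxn (size f) (size g).
rewrite (@mfun_widen m (f + g) n) ?size_polyD //.
rewrite (@mfun_widen m f n) ?leq_maxl // (@mfun_widen m g n) ?leq_maxr //.
by rewrite -big_split; apply: eq_bigr => k _; rewrite coefD mulrDl.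
Qed.

Lemma mfunZ m c f : mfun m (c *: f) = c * mfun m f.
Proof.
rewrite (@mfun_widen m (c *: f) (size f)) ?size_scale_leq // mulr_sumr.
by apply: eq_bigr => k _; rewrite coefZ mulrA.
Qed.

Lemma mfun0 m : mfun m 0 = 0.
Proof. by rewrite /mfun size_poly0 big_ord0. Qed.

Lemma mfun_sum m (I : Type) (r : seq I) (p : pred I) (f : I -> {poly F}) :
  mfun m (\sum_(i <- r | p i) f i) = \sum_(i <- r | p i) mfun m (f i).
Proof. by apply: (big_morph _ (mfunD m) (mfun0 m)). Qed.

Lemma mfunX m f : mfun m ('X * f) = mfun (fun k => m k.+1) f.
Proof.
rewrite (@mfun_widen m ('X * f) (size f).+1).
  rewrite big_ord_recl coefXM eqxx mul0r add0r.
  by apply: eq_bigr => k _; rewrite coefXM.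
by rewrite (leq_trans (size_polyMleq _ _)) // size_polyX.
Qed.

Lemma mfunXnr m f n : mfun m (f * 'X^n) = mfun (fun k => m (k + n)%N) f.
Proof.
elim: n m => [|n IH] m.
  by rewrite expr0 mulr1; apply: eq_bigr => k _; rewrite addn0.
rewrite exprS mulrCA mfunX IH.
by apply: eq_bigr => k _; rewrite addnS.
Qed.

(** An f orthogonal to all lower powers only sees the top coefficient of g. *)
Lemma mfun_mul_coef m f g n : (size g <= n.+1)%N ->
  (forall k, (k < n)%N -> mfun m (f * 'X^k) = 0) ->
  mfun m (f * g) = g`_n * mfun m (f * 'X^n).
Proof.
move=> sg ort.
have -> : g = \sum_(k < n.+1) g`_k *: 'X^k.
  rewrite -poly_def; apply/polyP => k; rewrite coef_poly.
  by case: ltnP => // /(leq_trans sg)/leq_sizeP->.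
rewrite big_distrr mfun_sum big_ord_recr /= big1 ?add0r => [|k _].
  rewrite -scalerAr mfunZ; congr (_ * _).
  rewrite coef_sum (bigD1 ord_max) //= coefZ coefXn eqxx mulr1 big1 ?addr0 // => k nk.
  by rewrite coefZ coefXn -val_eqE /= eq_sym in nk *; rewrite (negPf nk) mulr0.
by rewrite -scalerAr mfunZ ort ?mulr0.
Qed.

End MomentFunctional.

(** * Monic little q-Jacobi polynomials *)

Section LittleQJacobi.
Variables (R : realType) (q b : R).
Implicit Types (a : R) (m : nat -> R) (n k s : nat).
Hypotheses (q0 : 0 < q) (q1 : q < 1) (bq : b * q < 1).

(** Quotient of the k-th by the (k+1)-st coefficient of the monic little q-Jacobi
    polynomial of degree n with parameters a, b.  The recurrence [lqj_rec] is the
    eigenvalue equation of the q-difference operator with diagonal [qdiff_eig]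
    and subdiagonal [- qdiff_low]. *)
Definition lqj_fac a n k : R :=
  - (q ^+ n * (1 - q ^+ k.+1) * (1 - a * q ^+ k.+1)
     / (q * (q ^+ k - q ^+ n) * (1 - a * b * q ^+ (n + k).+1))).

Definition lqj_coef a n k : R := \prod_(k <= j < n) lqj_fac a n j.

Definition lqj a n : {poly R} := \poly_(k < n.+1) lqj_coef a n k.

Definition admissible a := 0 < a /\ a * q < 1.

(** The Pearson equation of the little q-Jacobi weight, read on its moments. *)
Definition lqj_moments a (m : nat -> R) :=
  forall k, (1 - a * b * q ^+ k.+2) * m k.+1 = (1 - a * q ^+ k.+1) * m k.

Lemma admissibleS a : admissible a -> admissible (a * q).
Proof.
move=> [a0 aq]; split; first by rewrite mulr_gt0.
by rewrite (lt_trans _ aq) // gtr_pMr ?mulr_gt0.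
Qed.

(** Multiplying the weight by the variable replaces a by aq and shifts the moments. *)
Lemma lqj_momentsS a m : lqj_moments a m -> lqj_moments (a * q) (fun k => m k.+1).
Proof.
move=> mm k; have := mm k.+1; rewrite (exprS _ k.+2) (exprS _ k.+1) !mulrA.
by rewrite (mulrAC a b).
Qed.

Lemma expq_lt1 n : 1 - q ^+ n.+1 > 0.
Proof. by rewrite subr_gt0 exprn_ilt1 // ltW. Qed.

Lemma expq_gt0 n : q ^+ n > 0. Proof. exact: exprn_gt0. Qed.

Lemma expq_neq n k : n != k -> q ^+ n - q ^+ k != 0.
Proof.
move=> nk; rewrite subr_eq0; apply: contra nk => /eqP e; apply/eqP.
by apply: (ieexprIn q0 _ e); rewrite lt_eqF.
Qed.

Lemma bexp_lt1 n : 1 - b * q ^+ n.+1 > 0.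
Proof.
rewrite subr_gt0 exprS mulrA; have [b0|b0] := leP b 0.
  by rewrite (le_lt_trans _ ltr01) // !pmulr_lle0 ?expq_gt0.
by rewrite (le_lt_trans _ bq) // ler_piMr ?mulr_ge0 ?exprn_ile1 ?ltW.
Qed.

Lemma aexp_lt1 a n : admissible a -> 1 - a * q ^+ n.+1 > 0.
Proof.
move=> [a0 aq]; rewrite subr_gt0 exprS mulrA.
by rewrite (le_lt_trans _ aq) // ler_piMr ?mulr_ge0 ?exprn_ile1 ?ltW.
Qed.

(** The exponent starts at 2 because a q < 1 and b q < 1 are the only bounds:
    a b q itself may be 1 or larger. *)
Lemma abexp_lt1 a n : admissible a -> 1 - a * b * q ^+ n.+2 > 0.
Proof.
move=> [a0 aq]; have := bexp_lt1 n; rewrite !subr_gt0 => bl.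
have -> : a * b * q ^+ n.+2 = (a * q) * (b * q ^+ n.+1) by rewrite !exprS; ring.
have [b0|b0] := leP (b * q ^+ n.+1) 0.
  by rewrite (le_lt_trans _ ltr01) // mulr_ge0_le0 // mulr_ge0 // ltW.
by rewrite (lt_trans _ bl) // gtr_pMl.
Qed.

Lemma lqj_coefS a n k : (k < n)%N ->
  lqj_coef a n k = lqj_fac a n k * lqj_coef a n k.+1.
Proof. by move=> kn; rewrite /lqj_coef big_ltn. Qed.

Lemma lqj_coefnn a n : lqj_coef a n n = 1.
Proof. by rewrite /lqj_coef big_geq. Qed.

Lemma size_lqj a n : size (lqj a n) = n.+1.
Proof. by rewrite size_poly_eq // lqj_coefnn oner_eq0. Qed.

Lemma coef_lqj a n k : (k <= n)%N -> (lqj a n)`_k = lqj_coef a n k.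
Proof. by move=> kn; rewrite coef_poly ltnS kn. Qed.

Lemma lead_lqj a n : (lqj a n)`_n = 1.
Proof. by rewrite coef_lqj // lqj_coefnn. Qed.

(** Up to an additive constant, the second-order little q-Jacobi q-difference
    operator sends the k-th power of the variable to [qdiff_eig a k] times
    itself minus [qdiff_low a k] times the preceding power. *)
Definition qdiff_eig a n := (q ^+ n)^-1 + a * b * q ^+ n.+1.
Definition qdiff_low a n := (1 - q ^+ n) * (1 - a * q ^+ n) / q ^+ n.

Lemma qdiff_eig_neq a n k : admissible a -> n != k -> qdiff_eig a n - qdiff_eig a k != 0.
Proof.
move=> aa nk; suff -> : qdiff_eig a n - qdiff_eig a k =
  (q ^+ k - q ^+ n) * (1 - a * b * q ^+ (n + k).+1) / (q ^+ n * q ^+ k).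
  rewrite mulf_neq0 ?invr_eq0 ?mulf_neq0 ?expq_neq ?(gt_eqF (expq_gt0 _)) //.
    by rewrite eq_sym.
  move: nk; case: (n + k)%N (addn_eq0 n k) => [|j] /=; last first.
    by rewrite (gt_eqF (abexp_lt1 _ aa)).
  by move=> /esym/andP [/eqP-> /eqP->].
rewrite /qdiff_eig !exprS exprD; field.
by rewrite !gt_eqF ?expq_gt0.
Qed.

Lemma lqj_rec a n k : admissible a -> (k < n)%N ->
  lqj_coef a n k.+1 * qdiff_low a k.+1 = (qdiff_eig a k - qdiff_eig a n) * lqj_coef a n k.
Proof.
move=> aa kn; rewrite (lqj_coefS _ kn) mulrC mulrA; congr (_ * _).
have nk : n != k by rewrite gtn_eqF.
have h1 := expq_neq nk; have h1' : q ^+ k - q ^+ n != 0 by rewrite expq_neq // eq_sym.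
have : (0 < n + k)%N by rewrite addn_gt0 (leq_ltn_trans _ kn).
case e : (n + k)%N => [//|j] _; have h2 := abexp_lt1 j aa.
rewrite /qdiff_low /qdiff_eig /lqj_fac e -e; rewrite -e in h2.
move: h2; rewrite !exprS !exprD => /lt0r_neq0 h2.
by field; rewrite h1' h2 !gt_eqF ?expq_gt0.
Qed.

Lemma qdiff_low0 a : qdiff_low a 0 = 0. Proof. by rewrite /qdiff_low expr0 subrr !mul0r. Qed.

(** The q-difference operator is symmetric for the moment functional, here on
    powers of the variable: the difference of the two sides is q^-s - q^-k times the
    Pearson equation. *)
Lemma lqj_moments_sym a m s k : lqj_moments a m ->
  qdiff_eig a s * m (k + s)%N - qdiff_low a s * m (k + s).-1 =
  qdiff_eig a k * m (k + s)%N - qdiff_low a k * m (k + s).-1.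
Proof.
move=> mm; case e : (k + s)%N => [|j] /=.
  by move/eqP: e; rewrite addn_eq0 => /andP[/eqP-> /eqP->].
have := mm j; rewrite (exprS _ j.+1) -[in q ^+ _]e exprD => E.
apply/eqP; rewrite -subr_eq0.
set K := q ^+ k in E *; set S := q ^+ s in E *.
have K0 : K != 0 by rewrite gt_eqF ?expq_gt0.
have S0 : S != 0 by rewrite gt_eqF ?expq_gt0.
suff -> : qdiff_eig a s * m j.+1 - qdiff_low a s * m j -
    (qdiff_eig a k * m j.+1 - qdiff_low a k * m j) =
  (S^-1 - K^-1) * ((1 - a * b * (q * (K * S))) * m j.+1 - (1 - a * (K * S)) * m j).
  by rewrite E subrr mulr0.
rewrite /qdiff_eig /qdiff_low !exprS -/K -/S; field; by rewrite K0 S0.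
Qed.

Lemma mfun_lqjXn a m n s :
  mfun m (lqj a n * 'X^s) = \sum_(k < n.+1) lqj_coef a n k * m (k + s)%N.
Proof.
rewrite mfunXnr (@mfun_widen _ _ _ n.+1) ?size_lqj //.
by apply: eq_bigr => k _; rewrite coef_lqj // -ltnS.
Qed.

(** Moving the operator from the eigenfunction [lqj a n] onto the power of degree s;
    the predecessor in the moment sequence encodes lowering that power by one. *)
Lemma lqj_orth_rec a m n s : admissible a -> lqj_moments a m ->
  (qdiff_eig a s - qdiff_eig a n) * mfun m (lqj a n * 'X^s) =
  qdiff_low a s * mfun (fun k => m k.-1) (lqj a n * 'X^s).
Proof.
move=> aa mm; rewrite !mfun_lqjXn.
set I := \sum_(k < _) _; set J := \sum_(k < _) _.
suff E : qdiff_eig a s * I - qdiff_low a s * J = qdiff_eig a n * I by rewrite mulrBl -E; ring.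
rewrite !mulr_sumr -sumrB.
transitivity (\sum_(k < n.+1) lqj_coef a n k *
    (qdiff_eig a k * m (k + s)%N - qdiff_low a k * m (k + s).-1)).
  apply: eq_bigr => k _; rewrite -(lqj_moments_sym s k mm). ring.
under eq_bigr do rewrite mulrBr.
rewrite sumrB [X in _ - X]big_ord_recl qdiff_low0 mul0r mulr0 add0r.
apply/eqP; rewrite subr_eq; apply/eqP; rewrite big_ord_recr [in RHS]big_ord_recr /=.
rewrite [RHS]addrAC -big_split /=; congr (_ + _); last by ring.
apply: eq_bigr => k _; rewrite /= [X in _ + X]mulrA lqj_rec //=; ring.
Qed.

(** By [lqj_orth_rec] the pairing with the s-th power is a multiple of the pairing
    with the preceding one as long as the eigenvalues of s and n differ, and for s = 0
    the lowering coefficient vanishes. *)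
Lemma lqj_orth a m n s : admissible a -> lqj_moments a m -> (s < n)%N ->
  mfun m (lqj a n * 'X^s) = 0.
Proof.
move=> aa mm; elim: s => [|s IH] sn; have := @lqj_orth_rec a m n _ aa mm.
  move=> /(_ 0%N) /eqP; rewrite qdiff_low0 mul0r mulf_eq0.
  by rewrite (negPf (qdiff_eig_neq _ _)) ?ltn_eqF //= => /eqP.
move=> /(_ s.+1) /eqP; rewrite mfun_lqjXn.
have -> : mfun (fun k => m k.-1) (lqj a n * 'X^(s.+1)) = mfun m (lqj a n * 'X^s).
  by rewrite !mfun_lqjXn; apply: eq_bigr => k _; rewrite addnS.
rewrite IH ?(ltnW sn) // mulr0 mulf_eq0.
by rewrite (negPf (qdiff_eig_neq _ _)) ?ltn_eqF //= => /eqP.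
Qed.

Lemma lqj_coef0 a n : admissible a ->
  lqj_coef a n 0 = (-1) ^+ n * q ^+ 'C(n, 2) *
    (qpoch (a * q) q n / qpoch (a * b * q ^+ n.+1) q n).
Proof.
move=> aa.
(* Induction downwards on the lower bound n - i of the index range. *)
suff H : forall i, (i <= n)%N -> \prod_(n - i <= j < n) lqj_fac a n j =
   (-1) ^+ i * q ^+ 'C(i, 2) * \prod_(n - i <= j < n)
    ((1 - q ^+ j.+1) * (1 - a * q ^+ j.+1) /
     ((1 - q ^+ (n - j)) * (1 - a * b * q ^+ (n + j).+1))).
  rewrite /lqj_coef -{1}(subnn n) H // subnn; congr (_ * _).
  rewrite big_mkord /qpoch; under eq_bigr do rewrite -mulf_div.
  rewrite big_split /= !prodf_div.
  have -> : \prod_(i < n) (1 - q ^+ (n - i)) = \prod_(i < n) (1 - q ^+ i.+1).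
    rewrite (reindex_inj rev_ord_inj) /=; apply: eq_bigr => i _.
    by rewrite subKn.
  rewrite divff ?mul1r; last first.
    by rewrite prodf_seq_neq0; apply/allP => i _; rewrite gt_eqF ?expq_lt1.
  congr (_ / _); apply: eq_bigr => i _; first by rewrite exprS mulrA.
  by rewrite -(mulrA (a * b)) -exprD addSn.
elim=> [|i IH] lin; first by rewrite subn0 !big_geq // !mulr1.
have e : (n - i = (n - i.+1).+1)%N by lia.
rewrite big_ltn; last by lia.
rewrite [in RHS]big_ltn; last by lia.
rewrite -e IH ?(ltnW lin) // binS bin1 exprD exprS.
suff -> : lqj_fac a n (n - i.+1) = - q ^+ i * ((1 - q ^+ (n - i)) * (1 - a * q ^+ (n - i)) /
  ((1 - q ^+ (n - (n - i.+1))) * (1 - a * b * q ^+ (n + (n - i.+1)).+1))) by ring.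
rewrite subKn // /lqj_fac e; set j := (n - i.+1)%N in e *.
have nj : n = (i + j.+1)%N by lia.
have h1 := expq_lt1 i; have : (0 < n + j)%N by lia.
case E: (n + j)%N => [//|l] _; have h2 := abexp_lt1 l aa; rewrite -E in h2 *.
move/lt0r_neq0: h2; set Z := _ - _ * q ^+ _ => h2; move/lt0r_neq0: h1.
rewrite nj !exprD !exprS => h1.
have := expq_gt0 j; have := expq_gt0 i => /lt0r_neq0 hi /lt0r_neq0 hj.
have hq := lt0r_neq0 q0.
have E2 : q ^+ j - q ^+ i * (q * q ^+ j) = q ^+ j * (1 - q * q ^+ i) by ring.
by field; rewrite E2 hq h1 h2 mulf_neq0.
Qed.

(** The ratio of the squared norm of the degree n polynomial with parameter a to that
    of the degree n - 1 polynomial with parameter a q^2, the latter for the weight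
    multiplied by the square of the variable (see [lqj_norm_rec]). *)
Definition norm_ratio a n :=
  a * q * (1 - q ^+ n) * (1 - b * q ^+ n)
  / ((1 - a * b * q ^+ n.+1) * (1 - a * q ^+ n.+1)).

Lemma lqj_fac_shift1 a n k : admissible a -> (k < n)%N ->
  lqj_fac (a * q) n k * ((1 - a * q ^+ k.+1) * (1 - a * b * q ^+ (n + k).+2)) =
  lqj_fac a n k * ((1 - a * q ^+ k.+2) * (1 - a * b * q ^+ (n + k).+1)).
Proof.
move=> aa kn; have h1 : q ^+ k - q ^+ n != 0 by rewrite expq_neq // ltn_eqF.
have hq := lt0r_neq0 q0.
have : (0 < n + k)%N by lia.
case E : (n + k)%N => [//|l] _; have := lt0r_neq0 (abexp_lt1 l aa).
have := lt0r_neq0 (abexp_lt1 l.+1 aa).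
rewrite /lqj_fac E (exprS _ l.+2) (exprS _ k.+1) !mulrA (mulrAC a q b).
move=> l1 l2.
by field; rewrite l1 l2 h1 hq.
Qed.

(** The quotient of the two coefficients is a telescoping product over
    [lqj_fac_shift1]. *)
Lemma lqj_coef_shift1 a n k : admissible a -> (k <= n)%N ->
  lqj_coef (a * q) n k * ((1 - a * q ^+ k.+1) * (1 - a * b * q ^+ (n + n).+1)) =
  lqj_coef a n k * ((1 - a * q ^+ n.+1) * (1 - a * b * q ^+ (n + k).+1)).
Proof.
move=> aa kn; rewrite -(subKn kn); elim: (n - k)%N (leq_subr k n) => [|i IH] lin.
  by rewrite subn0 !lqj_coefnn.
move/(_ (ltnW lin)): IH; have -> : (n - i = (n - i.+1).+1)%N by lia.
have : (n - i.+1 < n)%N by lia.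
move: (n - i.+1)%N => {kn lin}j jn IH.
rewrite !(lqj_coefS _ jn); have := lqj_fac_shift1 aa jn.
have l1 := lt0r_neq0 (aexp_lt1 j.+1 aa).
have l2 := lt0r_neq0 (abexp_lt1 (n + j) aa).
move: IH; rewrite addnS => IH st; apply: (mulfI (mulf_neq0 l1 l2)).
transitivity ((lqj_fac (a * q) n j * ((1 - a * q ^+ j.+1) * (1 - a * b * q ^+ (n + j).+2))) *
   (lqj_coef (a * q) n j.+1 * ((1 - a * q ^+ j.+2) * (1 - a * b * q ^+ (n + n).+1)))).
  by ring.
by rewrite IH st; ring.
Qed.

Lemma lqj_fac_shift2 a n k : admissible a -> (k < n)%N ->
  lqj_fac (a * q * q) n k * ((1 - q ^+ k.+2) * (1 - a * q ^+ k.+2)) =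
  lqj_fac a n.+1 k.+1 * ((1 - q ^+ k.+1) * (1 - a * q ^+ k.+3)).
Proof.
move=> aa kn; rewrite /lqj_fac.
have -> : 1 - a * q * q * q ^+ k.+1 = 1 - a * q ^+ k.+3 by rewrite !exprS; ring.
have -> : 1 - a * q * q * b * q ^+ (n + k).+1 = 1 - a * b * q ^+ (n.+1 + k.+1).+1.
  by rewrite addSn addnS !exprS; ring.
have h1 : q ^+ k - q ^+ n != 0 by rewrite expq_neq // ltn_eqF.
have hq := lt0r_neq0 q0.
have : 1 - a * b * q ^+ (n.+1 + k.+1).+1 != 0.
  by rewrite addSn; apply/lt0r_neq0/abexp_lt1.
set Z := 1 - a * b * _ => h2.
have -> : q ^+ k.+1 - q ^+ n.+1 = q * (q ^+ k - q ^+ n) by rewrite !exprS; ring.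
rewrite (exprS _ n); field.
by rewrite h1 h2 hq.
Qed.

(** Again a telescoping product, now over [lqj_fac_shift2]. *)
Lemma lqj_coef_shift2 a n k : admissible a -> (k <= n)%N ->
  lqj_coef (a * q * q) n k * ((1 - q ^+ n.+1) * (1 - a * q ^+ k.+2)) =
  lqj_coef a n.+1 k.+1 * ((1 - q ^+ k.+1) * (1 - a * q ^+ n.+2)).
Proof.
move=> aa kn; rewrite -(subKn kn); elim: (n - k)%N (leq_subr k n) => [|i IH] lin.
  by rewrite subn0 !lqj_coefnn.
move/(_ (ltnW lin)): IH; have -> : (n - i = (n - i.+1).+1)%N by lia.
have : (n - i.+1 < n)%N by lia.
move: (n - i.+1)%N => {kn lin}j jn IH.
rewrite (lqj_coefS _ jn) (@lqj_coefS _ n.+1) //; have := lqj_fac_shift2 aa jn.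
have l1 := lt0r_neq0 (aexp_lt1 j.+2 aa).
have l2 := lt0r_neq0 (expq_lt1 j.+1).
move=> st; apply: (mulfI (mulf_neq0 l1 l2)).
transitivity ((lqj_fac (a * q * q) n j * ((1 - q ^+ j.+2) * (1 - a * q ^+ j.+2))) *
   (lqj_coef (a * q * q) n j.+1 * ((1 - q ^+ n.+1) * (1 - a * q ^+ j.+3)))).
  by ring.
by rewrite IH st; ring.
Qed.

(** The polynomials for a, and X times those for a q^2, both differ from the one for
    a q by a multiple of the preceding polynomial for a q; this is the relation left
    after eliminating that multiple.  Coefficientwise it is a rational identity in
    q^k and q^n, because the shifts of a change coefficients by simple factors. *)
Lemma lqj_connection a n : admissible a ->
  lqj a n.+1 - norm_ratio a n.+1 *: ('X * lqj (a * q * q) n) =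
  (1 - norm_ratio a n.+1) *: lqj (a * q) n.+1.
Proof.
move=> aa; apply/polyP => k; rewrite coefB !coefZ coefXM.
have [kn|nk] := leqP k n.+1; last first.
  rewrite !(nth_default 0) ?size_lqj //; last by case: k nk.
  by case: eqP => [e|_]; rewrite ?mulr0 subr0.
rewrite (coef_lqj a kn) (coef_lqj (a * q) kn); have := lqj_coef_shift1 aa kn.
have l0 := lt0r_neq0 (aexp_lt1 k aa).
have l1 := lt0r_neq0 (aexp_lt1 n.+1 aa).
have l2 := lt0r_neq0 (abexp_lt1 n aa).
have : 1 - a * b * q ^+ (n.+1 + n.+1).+1 != 0.
  by rewrite addSn addnS; apply/lt0r_neq0/abexp_lt1.
set Z := 1 - _ => l3 E1.
have {}E1 : lqj_coef (a * q) n.+1 k = lqj_coef a n.+1 k * ((1 - a * q ^+ n.+2) *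
   (1 - a * b * q ^+ (n.+1 + k).+1)) / ((1 - a * q ^+ k.+1) * Z).
  by rewrite -E1 mulfK // mulf_neq0.
rewrite E1 /norm_ratio.
suff -> : (if k == 0%N then 0 else (lqj (a * q * q) n)`_k.-1) =
  lqj_coef a n.+1 k * ((1 - q ^+ k) * (1 - a * q ^+ n.+2)) /
    ((1 - q ^+ n.+1) * (1 - a * q ^+ k.+1)).
  have hn := lt0r_neq0 (expq_lt1 n).
  have EZ : Z = 1 - a * b * q * (q ^+ n.+1) ^+ 2.
    by rewrite /Z exprS exprD; ring.
  move: l0 l1 l2 l3 hn; rewrite EZ (exprS _ (n.+1 + k)) exprD (exprS _ n.+1) (exprS _ k).
  move: (q ^+ n.+1) (q ^+ k) (lqj_coef a n.+1 k) => Q x c l0 l1 l2 l3 hn.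
  by field; rewrite l0 l1 l2 l3 hn.
case: k kn {E1 l0} (aexp_lt1 k aa) => [|k] kn /lt0r_neq0 l0 /=.
  by rewrite expr0 subrr !mul0r mulr0 mul0r.
rewrite coef_lqj // -lqj_coef_shift2 // mulfK // mulf_neq0 //.
exact/lt0r_neq0/expq_lt1.
Qed.

(** Pair [lqj_connection] with the power of top degree: the polynomial for
    a q drops out, since its weight already carries one factor X of that power and
    leaves a lower power to pair with. *)
Lemma lqj_norm_rec a m n : admissible a -> lqj_moments a m ->
  mfun m (lqj a n.+1 * 'X^(n.+1)) =
  norm_ratio a n.+1 * mfun (fun k => m k.+2) (lqj (a * q * q) n * 'X^n).
Proof.
move=> aa mm; have := congr1 (fun f => mfun m (f * 'X^(n.+1))) (lqj_connection n aa).
rewrite mulrBl -scaleN1r -!(@scalerAl R {poly R}) mfunD !mfunZ.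
have -> : mfun m ('X * lqj (a * q * q) n * 'X^(n.+1)) =
    mfun (fun k => m k.+2) (lqj (a * q * q) n * 'X^n).
  by rewrite -mulrA mfunX exprS mulrCA mfunX.
have -> : mfun m (lqj (a * q) n.+1 * 'X^(n.+1)) = 0.
  rewrite exprS mulrCA mfunX lqj_orth //; first exact: admissibleS.
  exact: lqj_momentsS.
by rewrite mulr0 mulN1r => /eqP; rewrite subr_eq0 => /eqP.
Qed.

Lemma norm_ratio_gt0 a n : admissible a -> 0 < norm_ratio a n.+1.
Proof.
move=> aa; have := aa => -[a0 _].
rewrite /norm_ratio divr_gt0 ?mulr_gt0 ?expq_lt1 ?bexp_lt1 ?abexp_lt1 //.
by rewrite aexp_lt1.
Qed.

(** The norm recurrence ends at a zeroth moment, so positivity of the moments and of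
    the ratios suffices. *)
Lemma lqj_norm_gt0 a m n : admissible a -> lqj_moments a m -> (forall k, 0 < m k) ->
  0 < mfun m (lqj a n * 'X^n).
Proof.
move=> aa mm m0; elim: n a m aa mm m0 => [|n IH] a m aa mm m0.
  by rewrite mfun_lqjXn big_ord1 lqj_coefnn mul1r.
rewrite lqj_norm_rec // mulr_gt0 ?norm_ratio_gt0 // IH //.
  exact/admissibleS/admissibleS.
exact: lqj_momentsS (lqj_momentsS mm).
Qed.

End LittleQJacobi.

(** * Moments of the little q-Jacobi weight *)

Section Moments.
Local Open Scope classical_set_scope.
Variables (R : realType) (q b : R).
Hypotheses (q0 : 0 < q) (q1 : q < 1) (bq : b * q < 1).
Implicit Types (t : R) (n k x : nat).

Definition qbin_term t x : R := t ^+ x * (qpoch (b * q) q x / qpoch q q x).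

Lemma qbin_termS t x : qbin_term t x.+1 =
  t * ((1 - b * q ^+ x.+1) / (1 - q ^+ x.+1)) * qbin_term t x.
Proof.
by rewrite /qbin_term /qpoch !big_ord_recr /= -(mulrA b) -!exprS (exprS t) -mulf_div; ring.
Qed.

Lemma qbin_term_gt0 t x : 0 < t -> 0 < qbin_term t x.
Proof.
move=> t0; elim: x => [|x IH]; first by rewrite /qbin_term /qpoch !big_ord0 divr1 mulr1.
rewrite qbin_termS; apply: mulr_gt0 => //; apply: mulr_gt0 => //.
by rewrite divr_gt0 ?(expq_lt1 q0 q1) ?(bexp_lt1 q0 q1 bq).
Qed.

(** Ratio test: the quotient of consecutive terms tends to t, so the terms are
    eventually dominated by a geometric sequence of ratio (1 + t) / 2. *)
Lemma qbin_series_cvg t : 0 < t -> t < 1 -> cvgn (series (qbin_term t)).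
Proof.
move=> t0 t1; set s := (1 + t) / 2.
have s0 : 0 < s by rewrite /s; lra.
have s1 : s < 1 by rewrite /s; lra.
have ts : 0 < s - t by rewrite /s; lra.
clearbody s; pose c := s + t * `|b|.
have c0 : 0 < c by rewrite /c ltr_wpDr ?mulr_ge0 // ltW.
have [N HN] : exists N, forall x, (N <= x)%N -> q ^+ x.+1 * c <= s - t.
  have /cvgrPdist_le H : (fun n => q ^+ n) @ \oo --> (0 : R).
    by apply: cvg_expr; rewrite gtr0_norm.
  have /H [N _ HN] : 0 < (s - t) / c by rewrite divr_gt0.
  exists N => x Nx; rewrite -ler_pdivlMr //.
  have := HN x.+1 (leqW Nx).
  by rewrite sub0r normrN ger0_norm // exprn_ge0 // ltW.
pose z x := qbin_term t x / s ^+ x.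
have z0 x : 0 < z x by rewrite divr_gt0 ?qbin_term_gt0 ?exprn_gt0.
have zS x : (N <= x)%N -> z x.+1 <= z x.
  move=> /HN Hx; rewrite /z qbin_termS (exprSr s).
  set u := qbin_term t x; set S := s ^+ x.
  have u0 : 0 < u by apply: qbin_term_gt0.
  have S0 : 0 < S by apply: exprn_gt0.
  have y1 : 0 < 1 - q ^+ x.+1 by apply: expq_lt1.
  rewrite ler_pdivrMr ?mulr_gt0 //.
  have -> : u / S * (S * s) = s * u by field; rewrite gt_eqF.
  rewrite ler_pM2r // mulrA ler_pdivrMr //.
  have y0 : 0 < q ^+ x.+1 by apply: exprn_gt0.
  have : t * (- b * q ^+ x.+1) <= t * (`|b| * q ^+ x.+1).
    by rewrite ler_pM2l // ler_pM2r // -normrN ler_norm.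
  rewrite /c in Hx; nra.
pose K := \sum_(j < N.+1) z j.
have zK x : z x <= K.
  have [xN|Nx] := leqP x N.
    rewrite /K (bigD1 (Ordinal (xN : (x < N.+1)%N))) //= lerDl.
    by apply: sumr_ge0 => j _; rewrite ltW.
  have zN : z N <= K.
    by rewrite /K big_ord_recr /= lerDr; apply: sumr_ge0 => j _; rewrite ltW.
  rewrite -(subnK (ltnW Nx)); elim: (x - N)%N => [|i IH] //.
  by rewrite addSn (le_trans (zS _ _)) // leq_addl.
apply: (@series_le_cvg _ _ (geometric K s)).
- by move=> x; rewrite ltW ?qbin_term_gt0.
- by move=> x; rewrite /geometric /= mulr_ge0 ?exprn_ge0 ?(le_trans _ (zK 0%N)) // ltW.
- by move=> x; rewrite /geometric /= -ler_pdivrMr ?exprn_gt0 //; apply: zK.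
- by apply: is_cvg_geometric_series; rewrite gtr0_norm.
Qed.

Definition qbin_sum t : R := limn (series (qbin_term t)).

Lemma qbin_sum_gt0 t : 0 < t -> t < 1 -> 0 < qbin_sum t.
Proof.
move=> t0 t1; apply: (@lt_le_trans _ _ (series (qbin_term t) 1%N)).
  by rewrite seriesEord /= big_ord1 qbin_term_gt0.
apply: nondecreasing_cvgn_le; last exact: qbin_series_cvg.
by apply: nondecreasing_series => x _ _; rewrite ltW ?qbin_term_gt0.
Qed.

(** The q-difference equation behind the q-binomial theorem.  It comes from the
    two-term recurrence of the summands by comparing partial sums. *)
Lemma qbin_sum_shift t : 0 < t -> t < 1 ->
  (1 - b * q * t) * qbin_sum (q * t) = (1 - t) * qbin_sum t.
Proof.
move=> t0 t1.
have qt0 : 0 < q * t by rewrite mulr_gt0.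
have qt1 : q * t < 1 by rewrite (lt_trans _ t1) // gtr_pMl.
have c1 : series (qbin_term t) @ \oo --> qbin_sum t by exact: qbin_series_cvg.
have c2 : series (qbin_term (q * t)) @ \oo --> qbin_sum (q * t) by exact: qbin_series_cvg.
have E n : series (qbin_term t) n.+1 - series (qbin_term (q * t)) n.+1 =
   t * series (qbin_term t) n - b * q * t * series (qbin_term (q * t)) n.
  rewrite !seriesEord /= [X in X - _]big_ord_recl [X in _ - X]big_ord_recl /=.
  rewrite /qbin_term !expr0 !mulr_sumr -!sumrB [X in X + _ - _]mul1r opprD addrACA.
  rewrite mul1r subrr add0r -sumrB; apply: eq_bigr => x _.
  rewrite -/(qbin_term t x.+1) -/(qbin_term (q * t) x.+1) !qbin_termS.
  rewrite /qbin_term !exprMn !(exprS _ x).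
  have : 1 - q ^+ x.+1 != 0 by rewrite gt_eqF // expq_lt1.
  rewrite exprS; move: (qpoch _ _ _ / qpoch _ _ _) => Z h; field.
  exact: h.
have l1 : (fun n => series (qbin_term t) n.+1 - series (qbin_term (q * t)) n.+1) @ \oo -->
   qbin_sum t - qbin_sum (q * t).
  by apply: cvgB; [move: c1 | move: c2]; rewrite -cvg_shiftS.
have l2 : (fun n => t * series (qbin_term t) n - b * q * t * series (qbin_term (q * t)) n) @ \oo
   --> t * qbin_sum t - b * q * t * qbin_sum (q * t).
  by apply: cvgB; apply: cvgMr.
rewrite (funext E) in l1.
have H : t * qbin_sum t - b * q * t * qbin_sum (q * t) = qbin_sum t - qbin_sum (q * t).
  by rewrite (cvg_unique (@Rhausdorff R) l1 l2).
 apply/eqP; rewrite -subr_eq0; apply/eqP.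
move/eqP: H; rewrite -subr_eq0 => /eqP H.
by rewrite -[RHS]H; ring.
Qed.

Variable (a : R).
Hypothesis aa : admissible q a.

(** The k-th moment for masses q^x times [qbin_term a x] at the points q^x. *)
Definition moment k : R := qbin_sum (a * q ^+ k.+1).

Lemma moment_arg k : 0 < a * q ^+ k.+1 /\ a * q ^+ k.+1 < 1.
Proof.
have := aexp_lt1 q0 q1 k aa; rewrite subr_gt0; split=> //.
by rewrite mulr_gt0 ?exprn_gt0 ?(proj1 aa).
Qed.

Lemma moment_gt0 k : 0 < moment k.
Proof. by have [h1 h2] := moment_arg k; apply: qbin_sum_gt0. Qed.

Lemma moment_lqj : lqj_moments q b a moment.
Proof.
move=> k; have [h1 h2] := moment_arg k; rewrite -(qbin_sum_shift h1 h2) /moment.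
by rewrite !exprS; congr (_ * qbin_sum _); ring.
Qed.

Lemma moment_cvg k :
  series (fun x => (q ^+ x) ^+ k * (q ^+ x * qbin_term a x)) @ \oo --> moment k.
Proof.
have [h1 h2] := moment_arg k.
have -> : (fun x => (q ^+ x) ^+ k * (q ^+ x * qbin_term a x)) = qbin_term (a * q ^+ k.+1).
  apply/funext => x; rewrite /qbin_term exprMn -!exprM mulSn (mulnC k) exprD; ring.
exact: qbin_series_cvg.
Qed.

End Moments.

(** * Matrix orthogonality with invertible norms *)

Section MatrixOrthogonality.
Variables (K : numClosedFieldType) (d : nat).
Local Notation M := 'M[K]_d.+1.
Implicit Types (A : M) (P Q S D : {poly M}) (n k : nat).
Variable ip : {poly M} -> {poly M} -> M.
Hypothesis ipDl : forall P Q S : {poly M}, ip (P + Q) S = ip P S + ip Q S.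
Hypothesis ipMl : forall (A : M) (P Q : {poly M}), ip (A%:P * P) Q = A * ip P Q.
Hypothesis ipC : forall P Q, (ip P Q)^t* = ip Q P.
Hypothesis ipX : forall P Q : {poly M}, ip ('X * P) Q = ip P ('X * Q).
Variables (E : nat -> {poly M}) (N : nat -> M).
Hypothesis sizeE : forall n, (size (E n) <= n.+1)%N.
Hypothesis leadE : forall n, (E n)`_n = N n.
Hypothesis unitN : forall n, N n \is a GRing.unit.
Hypothesis orthE : forall n (Q : {poly M}), (size Q <= n)%N -> ip (E n) Q = 0.
Hypothesis unitH : forall n, ip (E n) (E n) \is a GRing.unit.

Lemma ipNl P Q : ip (- P) Q = - ip P Q.
Proof.
have -> : - P = (- 1)%:P * P by rewrite polyCN mulN1r.
by rewrite ipMl mulN1r.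
Qed.

Lemma ipBl P Q S : ip (P - Q) S = ip P S - ip Q S.
Proof. by rewrite ipDl ipNl. Qed.

Lemma adjmx_inj : injective (fun A : M => A ^t* : M).
Proof. by move=> A B AB; rewrite -(trmxCK A) AB trmxCK. Qed.

Lemma ip_eq0C P Q : ip P Q = 0 -> ip Q P = 0.
Proof.
move=> h; apply: adjmx_inj; rewrite ipC h; apply/matrixP=> i j.
by rewrite !mxE rmorph0.
Qed.

Lemma orthEr n Q : (size Q <= n)%N -> ip Q (E n) = 0.
Proof. by move=> sQ; apply/ip_eq0C/orthE. Qed.

Lemma ipDr P Q S : ip P (Q + S) = ip P Q + ip P S.
Proof.
apply: adjmx_inj; rewrite ipC ipDl -(ipC P Q) -(ipC P S); apply/matrixP=> i j.
by rewrite !mxE rmorphD.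
Qed.

Lemma ipMr (A : M) P Q : ip P (A%:P * Q) = ip P Q * A ^t*.
Proof.
apply: adjmx_inj; rewrite ipC ipMl -(ipC P Q); apply/matrixP=> i j.
rewrite !mxE rmorph_sum; apply: eq_bigr => k _.
by rewrite !mxE rmorphM /= conjCK mulrC.
Qed.

Lemma size_cancel_lead n (D : {poly M}) (S : {poly M}) :
  (size D <= n.+1)%N -> (size S <= n.+1)%N -> S`_n = D`_n -> (size (D - S)%R <= n)%N.
Proof.
move=> sD sS h; apply/leq_sizeP => j; rewrite leq_eqVlt => /predU1P [<-|nj].
  by rewrite coefB h subrr.
by rewrite coefB !nth_default ?subr0 // (leq_trans _ nj).
Qed.

Lemma size_polyCM (A : M) (P : {poly M}) : (size (A%:P * P)%R <= size P)%N.
Proof. by rewrite mul_polyC size_scale_leq. Qed.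

Lemma coef_polyCM (A : M) (P : {poly M}) n : (A%:P * P)`_n = A * P`_n.
Proof. by rewrite mul_polyC coefZ. Qed.

(** Peel off the leading coefficient of D: pairing with the top [E n] leaves only that
    coefficient times an invertible norm. *)
Lemma ortho_nondeg n (D : {poly M}) : (size D <= n)%N ->
  (forall k, (k < n)%N -> ip D (E k) = 0) -> D = 0.
Proof.
elim: n D => [|n IH] D sD hD; first by apply/eqP; rewrite -size_poly_eq0 -leqn0.
pose A := D`_n * (N n)^-1.
have sD' : (size (D - A%:P * E n)%R <= n)%N.
  apply: size_cancel_lead => //; first by rewrite (leq_trans (size_polyCM _ _)).
  by rewrite coef_polyCM leadE /A divrK.
have := hD n (ltnSn n); rewrite -[D in ip D](subrK (A%:P * E n)) ipDl orthEr // add0r ipMl.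
move/(congr1 (fun B => B * (ip (E n) (E n))^-1)); rewrite mulrK // mul0r.
move/(congr1 (fun B => B * N n)); rewrite /A divrK // mul0r => D0.
apply: IH => [|k kn]; last by rewrite hD // ltnW.
have := @size_cancel_lead n D 0 sD; rewrite subr0; apply; first by rewrite size_poly0.
by rewrite coef0 D0.
Qed.

Lemma ortho_unique (P : nat -> {poly M}) :
  (forall n, size (P n) = n.+1 /\ P n \is monic) ->
  (forall m n, m <> n -> ip (P m) (P n) = 0) ->
  forall n, (N n)%:P * P n = E n.
Proof.
move=> mP oP n; elim/ltn_ind: n => n IH.
apply/eqP; rewrite -subr_eq0; apply/eqP; apply: (@ortho_nondeg n) => [|k kn].
  apply: size_cancel_lead; [|exact: sizeE|].
    by rewrite (leq_trans (size_polyCM _ _)) // (proj1 (mP n)).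
  have [sP /monicP] := mP n; rewrite lead_coefE sP /= => lP.
  by rewrite leadE coef_polyCM lP mulr1.
rewrite ipBl -(IH _ kn) ipMl ipMr oP ?mul0r ?mulr0; last by move=> e; rewrite e ltnn in kn.
by rewrite IH // orthE ?subr0 // (leq_trans (sizeE k)).
Qed.

(** Subtract the multiples of [E n.+1] and [E n] that cancel the two top coefficients of
    X * E n.  What remains has degree less than n; it pairs to zero with [E k] for
    k < n - 1, and for k = n - 1 the pairing is H n times the adjoint of A (n - 1),
    which is what C n removes. *)
Lemma ortho_recurrence n :
  let A k := N k *m invmx (N k.+1) in
  let H k := ip (E k) (E k) in
  let C k := if k is m.+1 then H k *m (A m) ^t* *m invmx (H m) else 0 in
  exists B : M, 'X * E n = (A n)%:P * E n.+1 + B%:P * E n + (C n)%:P * E n.-1.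
Proof.
pose A k := N k * (N k.+1)^-1; pose H k := ip (E k) (E k).
pose C k := if k is m.+1 then H k * (A m) ^t* * (H m)^-1 else 0.
suff: exists B : M, 'X * E n = (A n)%:P * E n.+1 + B%:P * E n + (C n)%:P * E n.-1 by [].
have sX k : (size ('X * E k)%R <= k.+2)%N.
  by rewrite (leq_trans (size_polyMleq _ _)) // size_polyX /= ltnS.
have sXA k : (size ('X * E k - (A k)%:P * E k.+1)%R <= k.+1)%N.
  apply: size_cancel_lead => //; first by rewrite (leq_trans (size_polyCM _ _)).
  by rewrite coef_polyCM coefXM /= !leadE /A divrK.
set D := 'X * E n - (A n)%:P * E n.+1.
have sD0 : (size D <= n.+1)%N := sXA n.
pose B := D`_n * (N n)^-1; exists B.
have sD : (size (D - B%:P * E n)%R <= n)%N.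
  apply: size_cancel_lead => //; first by rewrite (leq_trans (size_polyCM _ _)).
  by rewrite coef_polyCM leadE /B divrK.
suff e : D - B%:P * E n - (C n)%:P * E n.-1 = 0.
  have {}e : D = B%:P * E n + (C n)%:P * E n.-1.
    by apply/eqP; rewrite -subr_eq0 opprD addrA e.
  by rewrite -addrA -e addrC subrK.
apply: (@ortho_nondeg n) => [|k kn].
  destruct n as [|n]; first by rewrite /C polyC0 mul0r subr0.
  rewrite (leq_trans (size_polyD _ _)) // geq_max sD size_polyN.
  by rewrite (leq_trans (size_polyCM _ _)).
have oE l : (k < l)%N -> ip (E l) (E k) = 0 
  by move=> kl; rewrite orthE // (leq_trans (sizeE k)).
rewrite !ipBl !ipMl (oE _ (leqW kn)) (oE _ kn) !mulr0 !subr0 ipX.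
destruct n as [|n]; first by [].
move: kn; rewrite ltnS leq_eqVlt => /predU1P [e|kn]; last first.
  by rewrite (oE n) // mulr0 subr0 orthE // (leq_trans (sX k)).
rewrite {}e {oE} -[X in ip _ X](subrK ((A n)%:P * E n.+1)) ipDr orthE // add0r ipMr.
by rewrite -/(H n.+1) -/(H n) divrK ?subrr //; apply: unitH.
Qed.

End MatrixOrthogonality.

(** * Summation of polynomials over the q-lattice *)

Section ComplexLimits.
Local Open Scope classical_set_scope.
Variable R : realType.

Lemma cvg_real_complex (u : nat -> R) (l : R) :
  u @ \oo --> l -> (fun n => (u n)%:C : R[i]^o) @ \oo --> (l%:C : R[i]^o).
Proof.
move=> /cvgrPdist_lt ul; apply/cvgrPdist_lt => e; rewrite ltcE => /andP[/eqP /= e1 e0].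
have [N _ HN] := ul _ e0; exists N => // n Nn; have := HN n Nn.
rewrite /= -rmorphB /= normc_def /= expr0n addr0 sqrtr_sqr.
by case: e e1 {e0 HN} => e i /= -> h; rewrite ltcR.
Qed.

Lemma lim_series_horner (w : nat -> R) (z : nat -> R) (m : nat -> R) (F : {poly R[i]}) :
  (forall k, series (fun x => z x ^+ k * w x) @ \oo --> m k) ->
  limn (series (fun x => (w x)%:C * F.[(z x)%:C] : R[i]^o)) = mfun (fun k => (m k)%:C) F.
Proof.
move=> mw; apply: cvg_lim; first exact: norm_hausdorff.
have -> : series (fun x => (w x)%:C * F.[(z x)%:C] : R[i]^o) =
    fun n => \sum_(k < size F) F`_k * (series (fun x => z x ^+ k * w x) n)%:C.
  apply/funext => n; rewrite seriesEord /=.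
  under eq_bigr do rewrite horner_coef mulr_sumr.
  rewrite exchange_big /=; apply: eq_bigr => k _.
  rewrite seriesEord /= rmorph_sum mulr_sumr; apply: eq_bigr => x _.
  by rewrite rmorphM rmorphXn /=; ring.
rewrite /mfun; elim: (size F) => [|N IH].
  under eq_fun do rewrite big_ord0.
  by rewrite big_ord0; apply: cvg_cst.
under eq_fun do rewrite big_ord_recr.
rewrite big_ord_recr /=; apply: cvgD; first exact: IH.
by apply: cvgMr; apply: cvg_real_complex.
Qed.

End ComplexLimits.

Lemma sum_ord2 (V : nmodType) (F : 'I_2 -> V) : \sum_k F k = F 0 + F 1.
Proof. by rewrite big_ord_recr big_ord1 /=; congr (F _ + F _); apply: val_inj. Qed.

(** * Entries of matrix polynomials *)

Section MatrixPolynomialEntries.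
Variable K : numClosedFieldType.
Implicit Types (P Q : {poly 'M[K]_2}) (i j : 'I_2).

Definition entry P i j : {poly K} := \poly_(k < size P) (P`_k i j).

Lemma coef_entry P i j k : (entry P i j)`_k = P`_k i j.
Proof.
rewrite coef_poly; case: ltnP => // /leq_sizeP -> //.
by rewrite mxE.
Qed.

Lemma entryD P Q i j : entry (P + Q) i j = entry P i j + entry Q i j.
Proof. by apply/polyP => k; rewrite coefD !coef_entry coefD mxE. Qed.

Lemma entry_mulC (A : 'M[K]_2) P i j :
  entry (A%:P * P) i j = A i 0 *: entry P 0 j + A i 1 *: entry P 1 j.
Proof.
apply/polyP => k; rewrite coefD !coefZ !coef_entry mul_polyC coefZ mxE.
by rewrite sum_ord2.
Qed.

Lemma entryX P i j : entry ('X * P) i j = 'X * entry P i j.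
Proof.
apply/polyP => k; rewrite coefXM !coef_entry coefXM.
by case: eqP => // _; rewrite mxE.
Qed.

Lemma size_entry P i j : (size (entry P i j) <= size P)%N.
Proof. exact: size_poly. Qed.

Lemma horner_entry P i j z : (P.[z%:M]) i j = (entry P i j).[z].
Proof.
rewrite horner_coef (horner_coef_wide _ (size_entry P i j)) summxE.
apply: eq_bigr => k _; rewrite coef_entry.
have -> : (z%:M : 'M[K]_2) ^+ k = (z ^+ k)%:M by rewrite rmorphXn.
by rewrite -mulmxE mul_mx_scalar mxE mulrC.
Qed.

Definition conjp (f : {poly K}) := map_poly Num.conj f.

Lemma conjpD f g : conjp (f + g) = conjp f + conjp g. Proof. exact: rmorphD. Qed.
Lemma conjpM f g : conjp (f * g) = conjp f * conjp g. Proof. exact: rmorphM. Qed.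
Lemma conjpK f : conjp (conjp f) = f.
Proof. by apply/polyP => k; rewrite !coef_map /= conjCK. Qed.
Lemma conjpZ c f : conjp (c *: f) = Num.conj c *: conjp f. Proof. exact: map_polyZ. Qed.
Lemma conjpX : conjp 'X = 'X. Proof. exact: map_polyX. Qed.

Lemma horner_conjp f z : z \is Num.real -> (conjp f).[z] = Num.conj f.[z].
Proof. by move=> /CrealP zr; rewrite -{1}zr horner_map. Qed.

Lemma mfun_conjp (m : nat -> K) f : (forall k, m k \is Num.real) ->
  mfun m (conjp f) = Num.conj (mfun m f).
Proof.
move=> mr; rewrite /mfun size_map_poly rmorph_sum; apply: eq_bigr => k _.
by rewrite coef_map rmorphM; congr (_ * _); apply/esym/CrealP.
Qed.

End MatrixPolynomialEntries.

(** * Diagonalisation of the weight *)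

Section WeightFactorisation.
Variables (R : realType) (q a b : R) (v : R[i]).
Local Notation K := (R[i]).
Implicit Types (P Q : {poly 'M[K]_2}) (i j : 'I_2).

(** The two entries of row i of P(z) A^x at z = q^x, as polynomials in z.  In these the
    inner product becomes two scalar little q-Jacobi inner products. *)
Definition trow1 P i : {poly K} := 'X * entry P i 0.
Definition trow2 P i : {poly K} := entry P i 1 - v *: ((1 - 'X) * entry P i 0).

Lemma trow1D P Q i : trow1 (P + Q) i = trow1 P i + trow1 Q i.
Proof. by rewrite /trow1 entryD mulrDr. Qed.
Lemma trow2D P Q i : trow2 (P + Q) i = trow2 P i + trow2 Q i.
Proof. by rewrite /trow2 !entryD mulrDr scalerDr opprD addrACA. Qed.
Lemma trow1M (A : 'M[K]_2) P i :
  trow1 (A%:P * P) i = A i 0 *: trow1 P 0 + A i 1 *: trow1 P 1.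
Proof. by rewrite /trow1 entry_mulC mulrDr -!scalerAr. Qed.
Lemma trow2M (A : 'M[K]_2) P i :
  trow2 (A%:P * P) i = A i 0 *: trow2 P 0 + A i 1 *: trow2 P 1.
Proof.
rewrite /trow2 !entry_mulC mulrDr -!scalerAr !scalerBr scalerDr !scalerA.
by rewrite opprD addrACA !(mulrC v).
Qed.
Lemma trow1X P i : trow1 ('X * P) i = 'X * trow1 P i.
Proof. by rewrite /trow1 entryX. Qed.
Lemma trow2X P i : trow2 ('X * P) i = 'X * trow2 P i.
Proof. by rewrite /trow2 !entryX mulrBr -scalerAr [in RHS]mulrCA. Qed.

Lemma mx2_mul (x y z t x' y' z' t' : K) :
  mx2 x y z t *m mx2 x' y' z' t' =
  mx2 (x * x' + y * z') (x * y' + y * t') (z * x' + t * z') (z * y' + t * t').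
Proof.
apply/matrixP => i j; rewrite mxE big_ord_recr big_ord1 /= !mxE /=.
by case: ifP => _; case: ifP.
Qed.

Lemma weight_base_pow x : mx2 q%:C (- (v * (1 - q)%:C)) 0 1 ^+ x =
  mx2 (q ^+ x)%:C (- (v * (1 - q ^+ x)%:C)) 0 1.
Proof.
elim: x => [|x IH].
  rewrite !expr0 subrr rmorph0 mulr0 oppr0; apply/matrixP => i j.
  by rewrite !mxE; case: i j => [[|[|]] // ?] [[|[|]] // ?].
rewrite exprS IH -mulmxE mx2_mul !exprS !rmorphB !rmorph1 !rmorphM /=.
by congr mx2; ring.
Qed.

Lemma adjmxX (A : 'M[K]_2) x : (A ^t*) ^+ x = (A ^+ x) ^t*.
Proof.
elim: x => [|x IH]; first by rewrite !expr0 trmx1 map_mx1.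
by rewrite exprS exprSr IH -!mulmxE trmx_mul map_mxM.
Qed.

Lemma weightE x : weight q a b v x =
  (qbin_term q b a x)%:C *: (mx2 (q ^+ x)%:C (- (v * (1 - q ^+ x)%:C)) 0 1 *m
     (mx2 (q ^+ x)%:C (- (v * (1 - q ^+ x)%:C)) 0 1) ^t*).
Proof. by rewrite /weight /= adjmxX weight_base_pow. Qed.

Lemma trow_mul P i x : let z := (q ^+ x)%:C in
  let Z := mxeval P z *m mx2 z (- (v * (1 - q ^+ x)%:C)) 0 1 in
  Z i 0 = (trow1 P i).[z] /\ Z i 1 = (trow2 P i).[z].
Proof.
move=> z Z; rewrite /Z /mxeval; split; rewrite mxE sum_ord2 !horner_entry !mxE /=.
  by rewrite mulr0 addr0 /trow1 hornerM hornerX mulrC.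
rewrite mulr1 /trow2 !hornerE /z !rmorphB rmorph1 /=.
ring.
Qed.

(** Integration against the little q-Jacobi weight. *)
Definition lqj_sum (f : {poly K}) := mfun (fun k => (moment q b a k)%:C) f.

Hypotheses (q0 : 0 < q) (q1 : q < 1) (bq : b * q < 1) (aa : admissible q a).

Lemma innerE P Q : inner q (weight q a b v) P Q = \matrix_(i, j)
  lqj_sum (trow1 P i * conjp (trow1 Q j) + trow2 P i * conjp (trow2 Q j)).
Proof.
apply/matrixP => i j; rewrite [RHS]mxE /lqj_sum.
rewrite -(lim_series_horner _ (moment_cvg q0 q1 bq aa)) mxE.
apply: (congr1 (fun u : nat -> R[i]^o => limn (series u))); apply/funext => x.
rewrite weightE mxE -!scalemxAr -!scalemxAl mxE.
set X := mxeval P _; set Y := mxeval Q _; set T := mx2 _ _ _ _.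
have -> : X *m (T *m T ^t*) *m Y ^t* = (X *m T) *m (Y *m T) ^t*.
  by rewrite trmx_mul map_mxM !mulmxA.
have [P1 P2] := trow_mul P i x; have [Q1 Q2] := trow_mul Q j x.
have zr : (q ^+ x)%:C \is Num.real by rewrite complex_real.
rewrite mxE sum_ord2 P1 P2 mxE [in X in _ + X]mxE ![(Y *m T)^T _ _]mxE Q1 Q2.
have hC (f : {poly K}) : (conjp f).[(q ^+ x)%:C] = Num.conj f.[(q ^+ x)%:C].
  exact: horner_conjp.
rewrite (hornerD (_ * conjp _)) !(hornerM _ (conjp _)) !hC (rmorphM _ (q ^+ x)) -mulrA.
by [].
Qed.

Local Notation ip := (inner q (weight q a b v)).

Lemma lqj_sumD f g : lqj_sum (f + g) = lqj_sum f + lqj_sum g. Proof. exact: mfunD. Qed.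
Lemma lqj_sumZ c f : lqj_sum (c *: f) = c * lqj_sum f. Proof. exact: mfunZ. Qed.

Lemma innerDl P Q S : ip (P + Q) S = ip P S + ip Q S.
Proof.
rewrite !innerE; apply/matrixP => i j; rewrite !mxE trow1D trow2D -lqj_sumD.
by congr lqj_sum; ring.
Qed.

Lemma innerMl (A : 'M[K]_2) P Q : ip (A%:P * P) Q = A * ip P Q.
Proof.
rewrite !innerE -mulmxE; apply/matrixP => i j; rewrite !mxE sum_ord2 !mxE trow1M trow2M.
by rewrite -!lqj_sumZ -lqj_sumD -!mul_polyC; congr lqj_sum; ring.
Qed.

Lemma innerC P Q : (ip P Q) ^t* = ip Q P.
Proof.
rewrite !innerE; apply/matrixP => i j; rewrite !mxE /lqj_sum -mfun_conjp.
  by rewrite conjpD !conjpM !conjpK; congr (mfun _ (_ + _)); apply: mulrC.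
by move=> k; rewrite complex_real.
Qed.

Lemma innerX P Q : ip ('X * P) Q = ip P ('X * Q).
Proof.
rewrite !innerE; apply/matrixP => i j; rewrite !mxE !trow1X !trow2X !conjpM !conjpX.
by congr lqj_sum; ring.
Qed.

End WeightFactorisation.

(** * Real orthogonal polynomials with complex coefficients *)

Section Lift.
Variable R : realType.
Local Notation K := (R[i]).

Definition liftC (f : {poly R}) : {poly K} := map_poly (real_complex R) f.

Lemma coef_liftC f k : (liftC f)`_k = (f`_k)%:C.
Proof. by rewrite coef_map. Qed.

Lemma size_liftC f : size (liftC f) = size f.
Proof. exact: size_map_poly. Qed.

Lemma conjp_liftC f : conjp (liftC f) = liftC f.
Proof. by apply/polyP => k; rewrite coef_map !coef_liftC; apply: conjc_real. Qed.

Lemma mfun_liftC (m : nat -> R) f :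
  mfun (fun k => (m k)%:C) (liftC f) = (mfun m f)%:C.
Proof.
rewrite /mfun size_liftC rmorph_sum; apply: eq_bigr => k _.
by rewrite coef_liftC rmorphM.
Qed.

Variables (q b a : R) (m : nat -> R).
Hypotheses (q0 : 0 < q) (q1 : q < 1) (bq : b * q < 1) (aa : admissible q a).
Hypothesis mm : lqj_moments q b a m.
Local Notation L := (mfun (fun k => (m k)%:C)).

Lemma mfun_liftC_lqjXn n s :
  L (liftC (lqj q b a n) * 'X^s) = (mfun m (lqj q b a n * 'X^s))%:C.
Proof. by rewrite -mfun_liftC /liftC rmorphM /= map_polyXn. Qed.

Lemma liftC_lqj_coef n (f : {poly K}) : (size f <= n.+1)%N ->
  L (liftC (lqj q b a n) * f) = f`_n * (mfun m (lqj q b a n * 'X^n))%:C.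
Proof.
move=> sf; rewrite -mfun_liftC_lqjXn; apply: mfun_mul_coef => // k kn.
by rewrite mfun_liftC_lqjXn lqj_orth.
Qed.

End Lift.

(** * The orthogonal polynomials in closed form *)

Section ExplicitPolynomials.
Variables (R : realType) (q a b : R) (v : R[i]).
Hypotheses (q0 : 0 < q) (q1 : q < 1) (bq : b * q < 1) (aa : admissible q a).
Local Notation K := (R[i]).
Implicit Types (n k : nat).

Let a2 := a * q * q.
Let aa2 : admissible q a2. Proof. exact/admissibleS/admissibleS. Qed.

Definition lqjC n : {poly K} := liftC (lqj q b a n).
Definition lqjC2 n : {poly K} := liftC (lqj q b a2 n).
(** The coefficient c of X r_(n-1) in the second row; together with the factor xi it is the solution of the 2 x 2 system expressing orthogonality of that row to the
    vector (z^n, v z^n) and the normalisation [xi_row2_coef]. *)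
Definition row2_coef n : K := - (v^* * xi q a b v n * (norm_ratio q b a n)%:C).

(** The entries are found by inverting P |-> P A^x: the transformed rows are to be
    (X r, v p) and (c X r', xi p'), as [trow_explicit_op] records, with r and r' the
    polynomials for a q^2 of degrees n and n - 1, and p and p' those for a of degrees
    n + 1 and n.  For n = 0 the truncated n.-1 is harmless since c = 0. *)
Definition op_entry00 n : {poly K} := lqjC2 n.
Definition op_entry01 n : {poly K} := v *: (lqjC n.+1 + (1 - 'X) * lqjC2 n).
Definition op_entry10 n : {poly K} := row2_coef n *: lqjC2 n.-1.
Definition op_entry11 n : {poly K} :=
  xi q a b v n *: lqjC n + v *: ((1 - 'X) * (row2_coef n *: lqjC2 n.-1)).

Definition explicit_op n : {poly 'M[K]_2} := \poly_(k < n.+1)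
  mx2 (op_entry00 n)`_k (op_entry01 n)`_k (op_entry10 n)`_k (op_entry11 n)`_k.

Lemma norm_ratio0 : norm_ratio q b a 0 = 0.
Proof. by rewrite /norm_ratio expr0 subrr mulr0 !mul0r. Qed.

Lemma norm_ratio_ge0 n : 0 <= norm_ratio q b a n.
Proof. by case: n => [|n]; rewrite ?norm_ratio0 // ltW // norm_ratio_gt0. Qed.

Lemma row2_coef0 : row2_coef 0 = 0.
Proof. by rewrite /row2_coef norm_ratio0 rmorph0 mulr0 oppr0. Qed.

Lemma normv2 : `|v| ^+ 2 = v * v^*.
Proof. exact: sqr_normc. Qed.

Lemma xiE n : xi q a b v n = (1 + `|v| ^+ 2 * (norm_ratio q b a n)%:C)^-1.
Proof.
have -> : norm_ratio q b a n = (a * q) * ((1 - q ^+ n) * (1 - b * q ^+ n)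
  / ((1 - a * b * q ^+ n.+1) * (1 - a * q ^+ n.+1))) by rewrite /norm_ratio !mulrA.
by rewrite /xi (rmorphM _ (a * q)) /=; congr (_^-1); ring.
Qed.

Lemma xi_den_gt0 n : 0 < 1 + `|v| ^+ 2 * (norm_ratio q b a n)%:C.
Proof.
rewrite ltr_pwDl // mulr_ge0 ?exprn_ge0 //.
by rewrite ler0c norm_ratio_ge0.
Qed.

Lemma xi_gt0 n : 0 < xi q a b v n.
Proof. by rewrite xiE invr_gt0 xi_den_gt0. Qed.

Lemma xi_row2_coef n : xi q a b v n - v * row2_coef n = 1.
Proof.
rewrite /row2_coef; have := xiE n; rewrite normv2 => E.
transitivity (xi q a b v n * (1 + v * v^* * (norm_ratio q b a n)%:C)); first by ring.
by rewrite E mulVf // -normv2 gt_eqF // xi_den_gt0.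
Qed.

Lemma size_lqjC n : size (lqjC n) = n.+1.
Proof. by rewrite size_liftC size_lqj. Qed.

Lemma size_lqjC2 n : size (lqjC2 n) = n.+1.
Proof. by rewrite size_liftC size_lqj. Qed.

Lemma lead_lqjC n : (lqjC n)`_n = 1.
Proof. by rewrite coef_liftC lead_lqj. Qed.

Lemma lead_lqjC2 n : (lqjC2 n)`_n = 1.
Proof. by rewrite coef_liftC lead_lqj. Qed.

Lemma coef_1BXM (f : {poly K}) k :
  ((1 - 'X) * f)`_k = f`_k - (if k is k'.+1 then f`_k' else 0).
Proof. by rewrite mulrBl mul1r coefB coefXM; case: k. Qed.

Lemma size_op_entry00 n : (size (op_entry00 n) <= n.+1)%N.
Proof. by rewrite size_lqjC2. Qed.

(** The two monic terms of degree n + 1 cancel. *)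
Lemma size_op_entry01 n : (size (op_entry01 n) <= n.+1)%N.
Proof.
apply/leq_sizeP => -[//|k] nk; rewrite coefZ coefD coef_1BXM.
rewrite (nth_default _ (_ : size (lqjC2 n) <= k.+1)%N) ?size_lqjC2 ?ltnS // sub0r.
move: nk; rewrite ltnS leq_eqVlt => /predU1P [<-|nk].
  by rewrite lead_lqjC lead_lqjC2 subrr mulr0.
by rewrite !nth_default ?size_lqjC ?size_lqjC2 // subrr mulr0.
Qed.

Lemma size_op_entry10 n : (size (op_entry10 n) <= n)%N.
Proof.
rewrite /op_entry10; case: n => [|n]; first by rewrite row2_coef0 scale0r size_poly0.
by rewrite (leq_trans (size_scale_leq _ _)) // size_lqjC2.
Qed.

Lemma size_op_entry11 n : (size (op_entry11 n) <= n.+1)%N.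
Proof.
rewrite /op_entry11 (leq_trans (size_polyD _ _)) // geq_max.
rewrite (leq_trans (size_scale_leq _ _)) ?size_lqjC //=.
rewrite (leq_trans (size_scale_leq _ _)) //; apply/leq_sizeP => -[//|k] nk.
have := size_op_entry10 n; rewrite coef_1BXM -/(op_entry10 n) => s3.
by rewrite !nth_default ?subrr // (leq_trans s3) // ltnW.
Qed.

Lemma coef_explicit_op n k : (explicit_op n)`_k =
  mx2 (op_entry00 n)`_k (op_entry01 n)`_k (op_entry10 n)`_k (op_entry11 n)`_k.
Proof.
rewrite coef_poly; case: ltnP => // nk.
have s3 := leqW (size_op_entry10 n).
rewrite !(nth_default 0) ?(leq_trans _ nk) ?size_op_entry00 ?size_op_entry01 ?size_op_entry11 //.
by apply/matrixP => i j; rewrite !mxE; case: ifP => _; case: ifP.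
Qed.

Lemma size_explicit_op n : (size (explicit_op n) <= n.+1)%N.
Proof. exact: size_poly. Qed.

Lemma entry_explicit_op n :
  [/\ entry (explicit_op n) 0 0 = op_entry00 n, entry (explicit_op n) 0 1 = op_entry01 n,
      entry (explicit_op n) 1 0 = op_entry10 n & entry (explicit_op n) 1 1 = op_entry11 n].
Proof. by split; apply/polyP => k; rewrite coef_entry coef_explicit_op mxE. Qed.

Lemma trow_explicit_op n :
  [/\ trow1 (explicit_op n) 0 = 'X * lqjC2 n, trow2 v (explicit_op n) 0 = v *: lqjC n.+1,
      trow1 (explicit_op n) 1 = row2_coef n *: ('X * lqjC2 n.-1) &
      trow2 v (explicit_op n) 1 = xi q a b v n *: lqjC n].
Proof.
rewrite /trow1 /trow2; have [-> -> -> ->] := entry_explicit_op n; split => //.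
- by rewrite /op_entry01 /op_entry00 scalerDr addrK.
- by rewrite -scalerAr.
- by rewrite /op_entry11 /op_entry10 addrK.
Qed.

(** The coefficient of degree n in the upper right entry, divided by v; this is where
    the form of [alpha] comes from. *)
Lemma subleading_alpha n :
  lqj_coef q b a n.+1 n + 1 - (if n is k.+1 then lqj_coef q b a2 n k else 0) =
  (1 - q ^+ n + a * q ^+ n.+1 - a * b * q ^+ (2 * n + 2))
       / (1 - a * b * q ^+ (2 * n + 2)).
Proof.
have E2 : q ^+ (2 * n + 2) = q ^+ 2 * (q ^+ n) ^+ 2 by rewrite addnC exprD mulnC exprM.
rewrite lqj_coefS // lqj_coefnn mulr1 /lqj_fac.
have E3 : q ^+ (n.+1 + n).+1 = q ^+ 2 * (q ^+ n) ^+ 2 by rewrite -E2; congr (_ ^+ _); lia.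
have := abexp_lt1 q0 q1 bq (2 * n) aa; rewrite -addn2 E3 E2 => /lt0r_neq0 h.
have hq := lt0r_neq0 q0; have h1 := lt0r_neq0 (expq_lt1 q0 q1 0).
have hn := lt0r_neq0 (expq_gt0 q0 n).
case: n E2 E3 h hn => [|n] E2 E3 h hn.
  rewrite !expr1 !expr0 in h h1 *; field.
  rewrite hq; move: h; rewrite expr1n mulr1 => ->.
  by rewrite h1.
rewrite lqj_coefS // lqj_coefnn mulr1 /lqj_fac.
have -> : q ^+ (n.+1 + n).+1 = (q ^+ n.+1) ^+ 2.
  by rewrite -exprM; congr (_ ^+ _); lia.
move: h hn; rewrite !(exprS q n.+1) !(exprS q n); move: (q ^+ n) => x h hn.
rewrite /a2; field.
have hx : x != 0 by move: hn; rewrite mulf_eq0 (negPf hq).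
have -> : (q * (q * x)) ^+ 2 = q ^+ 2 * (q * x) ^+ 2 by ring.
have -> : x - q * x = x * (1 - q ^+ 1) by ring.
have -> : q * x - q * (q * x) = q * x * (1 - q ^+ 1) by ring.
by rewrite h hq !mulf_neq0.
Qed.

Lemma lead_explicit_op n : (explicit_op n)`_n = Nmx q a b v n.
Proof.
have s3 : (op_entry10 n)`_n = 0 by rewrite nth_default // size_op_entry10.
rewrite coef_explicit_op /Nmx s3; congr mx2; first exact: lead_lqjC2.
  rewrite coefZ coefD coef_1BXM lead_lqjC2 /alpha -subleading_alpha addrA; congr (v * _).
  rewrite rmorphB rmorphD rmorph1 coef_liftC coef_lqj //; congr (_ - _).
  by case: n {s3} => // k; rewrite coef_liftC coef_lqj.
rewrite coefD !coefZ lead_lqjC mulr1 coef_1BXM -/(op_entry10 n) s3 sub0r mulrN -[RHS](xi_row2_coef n).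
congr (_ - v * _); case: n {s3} => [|n]; first by rewrite row2_coef0.
by rewrite coefZ lead_lqjC2 mulr1.
Qed.

Local Notation ip := (inner q (weight q a b v)).
Let mm := moment_lqj q0 q1 bq aa.
Let mm2 : lqj_moments q b a2 (fun k => moment q b a k.+2) :=
  lqj_momentsS (lqj_momentsS mm).

Definition mom_norm n : R := mfun (moment q b a) (lqj q b a n * 'X^n).
Definition mom_norm2 n : R := mfun (fun k => moment q b a k.+2) (lqj q b a2 n * 'X^n).

Lemma mom_norm_gt0 n : 0 < mom_norm n.
Proof. by apply: lqj_norm_gt0 => // k; apply: moment_gt0. Qed.

Lemma mom_norm2_gt0 n : 0 < mom_norm2 n.
Proof. by apply: lqj_norm_gt0 => // k; apply: moment_gt0. Qed.

Lemma mom_normS n : mom_norm n.+1 = norm_ratio q b a n.+1 * mom_norm2 n.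
Proof. exact: lqj_norm_rec. Qed.

Local Notation L := (lqj_sum q a b).

Lemma lqj_sum_lqjC n (f : {poly K}) : (size f <= n.+1)%N ->
  L (lqjC n * f) = f`_n * (mom_norm n)%:C.
Proof. exact: liftC_lqj_coef. Qed.

Lemma lqj_sum_XX (f g : {poly K}) :
  L (('X * f) * ('X * g)) = mfun (fun k => (moment q b a k.+2)%:C) (f * g).
Proof. by rewrite /lqj_sum -mulrA mfunX mulrCA mfunX. Qed.

Lemma lqj_sum_lqjC2 n (f : {poly K}) : (size f <= n.+1)%N ->
  L (('X * lqjC2 n) * ('X * f)) = f`_n * (mom_norm2 n)%:C.
Proof. by move=> sf; rewrite lqj_sum_XX liftC_lqj_coef. Qed.

Lemma conjp_XM (f : {poly K}) : conjp ('X * f) = 'X * conjp f.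
Proof. by rewrite conjpM conjpX. Qed.

Lemma size_conjp (f : {poly K}) : size (conjp f) = size f.
Proof. exact: size_map_poly. Qed.

Lemma size_trow2 (Q : {poly 'M[K]_2}) j : (size (trow2 v Q j) <= (size Q).+1)%N.
Proof.
apply/leq_sizeP => -[//|k] Qk; rewrite coefB coefZ coef_1BXM.
have z j' l : (size Q <= l)%N -> (entry Q j j')`_l = 0.
  by move=> Ql; rewrite nth_default // (leq_trans (size_entry _ _ _)).
by rewrite (z 1 k.+1) ?(z 0 k) ?(z 0 k.+1) ?subr0 ?mulr0 ?subr0 //; apply: leqW.
Qed.

(** The first row consists of orthogonal polynomials of degree larger than needed.  In the
    second row both scalar pairings are multiples of one coefficient of Q, and the
    choice of [row2_coef] makes them cancel by [mom_normS]. *)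
Lemma orth_explicit_op n (Q : {poly 'M[K]_2}) : (size Q <= n)%N -> ip (explicit_op n) Q = 0.
Proof.
move=> sQ; rewrite innerE //; apply/matrixP => i j; rewrite !mxE.
have [T11 T12 T21 T22] := trow_explicit_op n.
have s0 : (size (conjp (entry Q j 0%R)) <= n)%N.
  by rewrite size_conjp (leq_trans (size_entry _ _ _)).
have s2 : (size (conjp (trow2 v Q j)) <= n.+1)%N.
  by rewrite size_conjp (leq_trans (size_trow2 _ _)).
have E0 : conjp (trow1 Q j) = 'X * conjp (entry Q j 0) by rewrite conjp_XM.
have [->|->] : i = 0 \/ i = 1 by case: i => [[|[|]] // ?]; [left|right]; apply: val_inj.
  rewrite T11 T12 lqj_sumD E0 lqj_sum_lqjC2 ?(leqW s0) // nth_default // mul0r add0r.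
  by rewrite -scalerAl lqj_sumZ lqj_sum_lqjC ?(leqW s2) // nth_default // mul0r mulr0.
rewrite T21 T22 lqj_sumD E0 -!scalerAl !lqj_sumZ lqj_sum_lqjC //.
rewrite coef_map /= coefB coefZ coef_1BXM.
rewrite (nth_default _ (leq_trans (size_entry Q j 1) sQ)).
rewrite (nth_default _ (leq_trans (size_entry Q j 0) sQ)).
case: n sQ T11 T12 T21 T22 s0 s2 => [|n] sQ _ _ _ _ s0 s2.
  by rewrite (subrr (0 : K)) mulr0 (subrr (0 : K)) rmorph0 row2_coef0 !mul0r mulr0 addr0.
rewrite lqj_sum_lqjC2 // coef_map /=.
rewrite !sub0r mulrN opprK rmorphM /= mom_normS (rmorphM (real_complex R)) /= /row2_coef.
set c := Num.conj v; set u := Num.conj (entry Q j 0)`_n.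
set r := (norm_ratio _ _ _ _)%:C; set h := (mom_norm2 n)%:C.
move: (xi _ _ _ _ _) => x; ring.
Qed.

Lemma det_mx22 (x y z t : K) : \det (mx2 x y z t) = x * t - y * z.
Proof.
rewrite (expand_det_row _ 0) sum_ord2 /cofactor !det_mx11 !mxE /=; ring.
Qed.

(** The norm is diagonal, with positive diagonal entries. *)
Lemma unit_norm_explicit_op n : ip (explicit_op n) (explicit_op n) \is a GRing.unit.
Proof.
have [T11 T12 T21 T22] := trow_explicit_op n.
rewrite innerE //; set H := \matrix_(i, j) _.
have H00 : 0 < H 0 0.
  rewrite mxE T11 T12 conjp_XM conjpZ !conjp_liftC lqj_sumD -scalerAl -scalerAr !lqj_sumZ.
  rewrite lqj_sum_lqjC2 ?size_lqjC2 // lqj_sum_lqjC ?size_lqjC // lead_lqjC2 lead_lqjC !mul1r mulrA.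
  by rewrite ltr_pwDl ?ltcR ?mom_norm2_gt0 // mulr_ge0 ?mul_conjC_ge0 // lecR ltW // mom_norm_gt0.
have H11 : 0 < H 1 1.
  rewrite mxE T21 T22 conjpZ conjp_XM !conjpZ !conjp_liftC lqj_sumD -!scalerAl -!scalerAr !lqj_sumZ.
  rewrite lqj_sum_lqjC2 ?size_lqjC2 // lqj_sum_lqjC ?size_lqjC // lead_lqjC2 lead_lqjC !mul1r !mulrA.
  rewrite ltr_wpDl //.
    by rewrite mulr_ge0 ?mul_conjC_ge0 // lecR ltW // mom_norm2_gt0.
  by rewrite mulr_gt0 ?mul_conjC_gt0 ?ltcR ?mom_norm_gt0 // gt_eqF // xi_gt0.
have H01 : H 0 1 = 0.
  rewrite mxE T11 T12 T21 T22 !conjpZ conjp_XM !conjp_liftC lqj_sumD -!scalerAl -!scalerAr !lqj_sumZ.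
  rewrite (lqj_sum_lqjC (n := n.+1)) ?size_lqjC // nth_default ?size_lqjC // mul0r !mulr0 addr0.
  case: n {T11 T12 T21 T22 H H00 H11} => [|n]; first by rewrite row2_coef0 rmorph0 mul0r.
  by rewrite lqj_sum_lqjC2 ?size_lqjC2 // nth_default ?size_lqjC2 // mul0r mulr0.
rewrite unitmxE.
have -> : H = mx2 (H 0 0) (H 0 1) (H 1 0) (H 1 1).
  apply/matrixP => i j; rewrite [in RHS]mxE.
  by case: i j => [[|[|]] // ?] [[|[|]] // ?] /=; congr (H _ _); apply: val_inj.
by rewrite det_mx22 H01 mul0r subr0 unitfE mulf_neq0 ?gt_eqF.
Qed.

End ExplicitPolynomials.

(** * Values at the origin *)

Section ValuesAtZero.
Variables (R : realType) (q a b : R) (v : R[i]).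
Hypotheses (q0 : 0 < q) (q1 : q < 1) (bq : b * q < 1) (aa : admissible q a).
Local Notation K := (R[i]).

Lemma at0_kappa11 n : (lqjC2 q a b n)`_0 = kappa11 q a b n.
Proof.
rewrite coef_liftC coef_lqj // lqj_coef0 //; last exact/admissibleS/admissibleS.
rewrite /kappa11; congr (_ * (qpoch _ _ _ / qpoch _ _ _))%:C; rewrite ?addn3 !exprS; ring.
Qed.

Lemma at0_kappa12 n : v * (lqjC q a b n.+1)`_0 = kappa12 q a b v n.
Proof. by rewrite coef_liftC coef_lqj // lqj_coef0 // /kappa12 addn2. Qed.

Lemma at0_kappa22 n : xi q a b v n * (lqjC q a b n)`_0 = kappa22 q a b v n.
Proof. by rewrite coef_liftC coef_lqj // lqj_coef0. Qed.

Lemma at0_kappa21 n : row2_coef q a b v n * (lqjC2 q a b n.-1)`_0 = kappa21 q a b v n.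
Proof.
case: n => [|n]; first by rewrite row2_coef0 /kappa21 expr0 subrr !(mul0r, mulr0, rmorph0).
rewrite at0_kappa11 /row2_coef /kappa21 /kappa11 /=.
set c := Num.conj v.
rewrite mulNr -mulrN -[LHS]mulrA (mulrC c); congr (_ * _).
rewrite -rmorphN -rmorphM; congr _%:C.
have -> : ('C(n.+1, 2) + 2 - n.+1 = 'C(n, 2) + 1)%N by rewrite binS bin1; lia.
have l1 := lt0r_neq0 (aexp_lt1 q0 q1 0 aa).
have l2 := lt0r_neq0 (aexp_lt1 q0 q1 1 aa).
have l3 := lt0r_neq0 (aexp_lt1 q0 q1 n.+1 aa).
have l4 := lt0r_neq0 (abexp_lt1 q0 q1 bq n aa).
have E1 : qpoch (a * q) q n.+1 * (1 - a * q ^+ n.+2) =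
    (1 - a * q ^+ 1) * (1 - a * q ^+ 2) * qpoch (a * q ^+ 3) q n.
  transitivity (qpoch (a * q) q n.+2).
    by rewrite [RHS]/qpoch big_ord_recr /= -mulrA -exprS.
  rewrite /qpoch 2!big_ord_recl /= mulrA; congr (_ * _ * _); rewrite ?expr1 ?expr0 ?mulr1 ?expr2 ?mulrA //.
  by apply: eq_bigr => i _; rewrite !exprS; ring.
have E2 : qpoch (a * b * q ^+ n.+2) q n.+1 =
    (1 - a * b * q ^+ n.+2) * qpoch (a * b * q ^+ (n + 3)) q n.
  rewrite /qpoch big_ord_recl expr0 mulr1; congr (_ * _).
  by apply: eq_bigr => i _; rewrite addn3 !exprS; ring.
have P2 : qpoch (a * b * q ^+ (n + 3)) q n != 0.
  rewrite prodf_seq_neq0; apply/allP => i _; rewrite -mulrA -exprD addn3 addSn.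
  by apply/lt0r_neq0/abexp_lt1.
have -> : qpoch (a * q) q n.+1 =
    (1 - a * q ^+ 1) * (1 - a * q ^+ 2) * qpoch (a * q ^+ 3) q n / (1 - a * q ^+ n.+2).
  by rewrite -E1 mulfK.
rewrite E2 /norm_ratio addn1; move: (qpoch (a * q ^+ 3) q n) => Y.
move: (qpoch (a * b * q ^+ (n + 3)) q n) P2 => Z Z0.
move: l1 l2 l3 l4; rewrite !(exprS q n.+1) !(exprS q n) (exprS q 'C(n, 2)) (exprS (-1) n) expr2 expr1.
by move=> l1 l2 l3 l4; field; rewrite l1 l2 l3 l4 Z0.
Qed.

Lemma mxeval_explicit_op0 n : mxeval (explicit_op q a b v n) 0 =
  mx2 (kappa11 q a b n) (kappa12 q a b v n + kappa11 q a b n * v)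
    (kappa21 q a b v n) (kappa22 q a b v n + kappa21 q a b v n * v).
Proof.
have [E1 E2 E3 E4] := entry_explicit_op q a b v n.
have e (i j : 'I_2) :
    mxeval (explicit_op q a b v n) 0 i j = (entry (explicit_op q a b v n) i j)`_0.
  by rewrite /mxeval horner_entry horner_coef0.
have -> : mxeval (explicit_op q a b v n) 0 = mx2 (mxeval (explicit_op q a b v n) 0 0 0)
  (mxeval (explicit_op q a b v n) 0 0 1) (mxeval (explicit_op q a b v n) 0 1 0)
  (mxeval (explicit_op q a b v n) 0 1 1).
  apply/matrixP => i j; rewrite [in RHS]mxE.
  by case: i j => [[|[|]] // ?] [[|[|]] // ?] /=; congr (mxeval _ _ _ _); apply: val_inj.
rewrite !e E1 E2 E3 E4 -at0_kappa11 -at0_kappa12 -at0_kappa22 -at0_kappa21; congr mx2.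
- by rewrite coefZ coefD coef_1BXM subr0 mulrDr (mulrC _ v).
- by rewrite coefZ.
- by rewrite coefD !coefZ coef_1BXM subr0 coefZ (mulrC _ v).
Qed.

End ValuesAtZero.

(** * Determinant, leading coefficients and the recurrence *)

Section Conclusion.
Variables (R : realType) (q a b : R) (v : R[i]).
Hypotheses (q0 : 0 < q) (q1 : q < 1) (bq : b * q < 1) (aa : admissible q a).
Local Notation K := (R[i]).

Lemma qpoch_gt0 (c : R) n : (forall i, (i < n)%N -> 0 < 1 - c * q ^+ i) -> 0 < qpoch c q n.
Proof. by move=> h; rewrite prodr_gt0 // => i _; apply: h. Qed.

(** The signs cancel in both products, leaving xi > 0 times the sum of a positive term
    and a nonnegative multiple of |v|^2. *)
Lemma det_at0_gt0 n :
  0 < kappa11 q a b n * kappa22 q a b v n - kappa21 q a b v n * kappa12 q a b v n.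
Proof.
have qa k : 0 < qpoch (a * q ^+ k.+1) q n.
  by apply: qpoch_gt0 => i _; rewrite -mulrA -exprD addSn aexp_lt1.
have qab k : 0 < qpoch (a * b * q ^+ (n + k.+1)) q n.
  apply: qpoch_gt0 => i ilt; rewrite -mulrA -exprD.
  by rewrite (_ : n + k.+1 + i = (n.-1 + k + i).+2)%N ?abexp_lt1 //; lia.
have qa' : 0 < qpoch (a * q) q n.+1.
  by apply: qpoch_gt0 => i _; rewrite -mulrA -exprS aexp_lt1.
have qab' : 0 < qpoch (a * b * q ^+ (n + 2)) q n.+1.
  by apply: qpoch_gt0 => i _; rewrite -mulrA -exprD addn2 !addSn abexp_lt1.
have qe k : 0 < q ^+ k by apply: expq_gt0.
have x0 := xi_gt0 v q0 q1 bq aa n.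
have -> : kappa11 q a b n * kappa22 q a b v n - kappa21 q a b v n * kappa12 q a b v n =
  xi q a b v n * ((q ^+ 'C(n, 2) * q ^+ 'C(n, 2) *
     ((qpoch (a * q ^+ 3) q n / qpoch (a * b * q ^+ (n + 3)) q n) *
      (qpoch (a * q ^+ 1) q n / qpoch (a * b * q ^+ (n + 1)) q n)))%:C +
    (v * v^*) * (a * q ^+ ('C(n, 2) + 2 - n) * q ^+ 'C(n.+1, 2) *
     ((1 - q ^+ n) * (1 - b * q ^+ n) / ((1 - a * q) * (1 - a * q ^+ 2))) *
     (qpoch (a * q ^+ 1) q n / qpoch (a * b * q ^+ (n + 1)) q n) *
     (qpoch (a * q) q n.+1 / qpoch (a * b * q ^+ (n + 2)) q n.+1))%:C).
  have sg : (-1) ^+ n * (-1) ^+ n = 1 :> R by rewrite -expr2 sqrr_sign.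
  rewrite /kappa11 /kappa12 /kappa21 /kappa22 expr1 addn1.
  move: (qpoch _ q n / _) (qpoch _ q n / _) (qpoch _ q n.+1 / _) (_ / ((1 - a * q) * _)) => w1 w2 w3 w4.
  rewrite (exprS (-1)); move: sg (xi _ _ _ _ _).
  move: ((-1) ^+ n) (q ^+ 'C(n, 2)) (q ^+ 'C(n.+1, 2)) (q ^+ _) => s x1 x2 x3 ss y.
  have -> : x3 * x3 * (w2 * w1) = (s * x3 * w2) * (s * x3 * w1).
    by transitivity (s * s * (x3 * x3 * (w2 * w1))); [rewrite ss mul1r | ring].
  set x4 := q ^+ _.
  have -> : a * x4 * x2 * w4 * w1 * w3 = (s * a * x4 * w4 * w1) * (s * x2 * w3).
    by transitivity (s * s * (a * x4 * x2 * w4 * w1 * w3)); [rewrite ss mul1r | ring].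
  rewrite mulN1r !mulNr rmorphN (rmorphM _ (s * x3 * w2)) (rmorphM _ (s * a * x4 * w4 * w1)) /=.
  by ring.
have w1 := divr_gt0 (qa 0%N) (qab 0%N); have w2 := divr_gt0 (qa 2%N) (qab 2%N).
have w3 := divr_gt0 qa' qab'.
apply: mulr_gt0 => //; apply: ltr_pwDl.
  by rewrite ltcR; apply: mulr_gt0; apply: mulr_gt0.
apply: mulr_ge0; first exact: mul_conjC_ge0.
rewrite lecR; apply: mulr_ge0 (ltW w3); apply: mulr_ge0 (ltW w1); apply: mulr_ge0.
  by rewrite !mulr_ge0 ?ltW // (proj1 aa).
apply: divr_ge0; last first.
  have := aexp_lt1 q0 q1 0 aa; rewrite expr1 => h1.
  by rewrite mulr_ge0 ?ltW // aexp_lt1.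
case: n {qa qab qa' qab' w1 w2 w3 x0} => [|m]; first by rewrite expr0 subrr mul0r.
by rewrite mulr_ge0 ?ltW // ?expq_lt1 // bexp_lt1.
Qed.

Lemma Nmx_mul n (x : K) : Nmx q a b v n *m mx2 1 x 0 1 = mx2 1 (x + alpha q a b v n) 0 1.
Proof. by rewrite /Nmx mx2_mul; congr mx2; ring. Qed.

Lemma mx2_id : mx2 1 0 0 1 = 1%:M :> 'M[K]_2.
Proof. by apply/matrixP => i j; rewrite !mxE; case: i j => [[|[|]] // ?] [[|[|]] // ?]. Qed.

Lemma Nmx_inv n : Nmx q a b v n *m mx2 1 (- alpha q a b v n) 0 1 = 1%:M.
Proof. by rewrite Nmx_mul addNr mx2_id. Qed.

Lemma unit_Nmx n : Nmx q a b v n \in unitmx.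
Proof. by have [] := mulmx1_unit (Nmx_inv n). Qed.

Lemma Nmx_ratio n : Nmx q a b v n *m invmx (Nmx q a b v n.+1) =
  mx2 1 (- (((q ^+ n * (1 - q) * (1 - a * q) * (1 + a * b * q ^+ (2 * n + 3)))
             / ((1 - a * b * q ^+ (2 * n + 2)) * (1 - a * b * q ^+ (2 * n + 4))))%:C * v)) 0 1.
Proof.
have -> : invmx (Nmx q a b v n.+1) = mx2 1 (- alpha q a b v n.+1) 0 1.
  by rewrite -[RHS](mulKmx (unit_Nmx n.+1)) Nmx_inv mulmx1.
rewrite Nmx_mul /alpha; congr mx2.
set r0 := (_ / (1 - a * b * q ^+ (2 * n.+1 + 2))).
set r1 := (_ / (1 - a * b * q ^+ (2 * n + 2))).
set r := (_ / (_ * _)).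
suff D : r = r0 - r1 by rewrite D rmorphB /=; ring.
rewrite {}/r {}/r0 {}/r1.
have := abexp_lt1 q0 q1 bq (2 * n) aa; have := abexp_lt1 q0 q1 bq (2 * n.+1) aa.
rewrite (_ : 2 * n.+1 + 2 = (2 * n).+4)%N; last by lia.
rewrite (_ : (2 * n.+1).+2 = (2 * n).+4)%N; last by lia.
rewrite addn2 addn3 addn4.
rewrite !(exprS q (2 * n).+3) !(exprS q (2 * n).+2) !(exprS q (2 * n).+1).
rewrite !(exprS q (2 * n)) !(exprS q n.+1) !(exprS q n).
rewrite (mulnC 2 n) exprM; move: (q ^+ n) => x.
move=> /lt0r_neq0 h1 /lt0r_neq0 h2; field.
by rewrite h1 h2.
Qed.

End Conclusion.
Theorem mainTheorem10 (R : realType) (q a b : R) (v : R[i])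
    (hq0 : 0 < q) (hq1 : q < 1)
    (ha0 : 0 < a) (haq : a < q^-1) (hbq : b < q^-1)
    (P : nat -> {poly 'M[R[i]]_2})
    (hP : monic_orthogonal q (weight q a b v) P) :
  let N := Nmx q a b v in
  let k11 := kappa11 q a b in
  let k12 := kappa12 q a b v in
  let k21 := kappa21 q a b v in
  let k22 := kappa22 q a b v in
  let Pt (n : nat) : {poly 'M[R[i]]_2} := (N n)%:P * P n in
  let H (n : nat) : 'M[R[i]]_2 := inner q (weight q a b v) (Pt n) (Pt n) in
  let A (n : nat) : 'M[R[i]]_2 := N n *m invmx (N n.+1) in
  let C (n : nat) : 'M[R[i]]_2 :=
    if n is m.+1 then H n *m (A m) ^t* *m invmx (H m) else 0 in
  let B (n : nat) : 'M[R[i]]_2 :=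
    - (A n *m mxeval (Pt n.+1) 0 *m invmx (mxeval (Pt n) 0))
    - C n *m mxeval (Pt n.-1) 0 *m invmx (mxeval (Pt n) 0) in
  forall n : nat,
  [/\ mxeval (Pt n) 0 =
        mx2 (k11 n) (k12 n + k11 n * v) (k21 n) (k22 n + k21 n * v),
      \det (mxeval (Pt n) 0) = k11 n * k22 n - k21 n * k12 n /\
        0 < \det (mxeval (Pt n) 0),
      N n.+1 \in unitmx /\ H n \in unitmx,
      A n = mx2 1
              (- (((q ^+ n * (1 - q) * (1 - a * q)
                     * (1 + a * b * q ^+ (2 * n + 3)))
                   / ((1 - a * b * q ^+ (2 * n + 2))
                      * (1 - a * b * q ^+ (2 * n + 4))))%:C * v))
              0 1
    & forall z : R[i],
        z *: mxeval (Pt n) z =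
          A n *m mxeval (Pt n.+1) z + B n *m mxeval (Pt n) z
          + C n *m mxeval (Pt n.-1) z].
Proof.
move=> N k11 k12 k21 k22 Pt H A C B n.
have bq : b * q < 1 by rewrite -ltr_pdivlMr // mul1r.
have aa : admissible q a by split => //; rewrite -ltr_pdivlMr // mul1r.
have iDl := innerDl v hq0 hq1 bq aa; have iMl := innerMl v hq0 hq1 bq aa.
have iC := innerC v hq0 hq1 bq aa; have iX := innerX v hq0 hq1 bq aa.
have sE := size_explicit_op q a b v.
have lE := lead_explicit_op v hq0 hq1 bq aa.
have oE := orth_explicit_op v hq0 hq1 bq aa.
have uH := unit_norm_explicit_op v hq0 hq1 bq aa.
have uN m : Nmx q a b v m \is a GRing.unit := unit_Nmx q a b v m.
have PtE m : Pt m = explicit_op q a b v m.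
  exact: (ortho_unique iDl iMl iC sE lE uN oE uH (proj1 hP) (proj2 hP)).
have HE m : H m = inner q (weight q a b v) (explicit_op q a b v m) (explicit_op q a b v m).
  by rewrite /H PtE.
have V0 m := mxeval_explicit_op0 v hq0 hq1 bq aa m.
have dE m : \det (mxeval (Pt m) 0) = k11 m * k22 m - k21 m * k12 m.
  by rewrite PtE V0 det_mx22 -/(k11 m) -/(k12 m) -/(k21 m) -/(k22 m); ring.
have d0 m : 0 < \det (mxeval (Pt m) 0) by rewrite dE det_at0_gt0.
split.
- by rewrite PtE V0.
- by split.
- by split; [apply: unit_Nmx | rewrite /H PtE; apply: uH].
- exact: Nmx_ratio.
have [B' rec] := ortho_recurrence iDl iMl iC iX sE lE uN oE uH n.
have evM (M : 'M[R[i]]_2) (S : {poly 'M[R[i]]_2}) z : mxeval (M%:P * S) z = M *m mxeval S z.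
  by rewrite /mxeval hornerCM mulmxE.
have evX (S : {poly 'M[R[i]]_2}) z : mxeval ('X * S) z = z *: mxeval S z.
  by rewrite /mxeval -commr_polyX hornerMX -mulmxE mul_mx_scalar.
have C_E : C n = if n is m.+1 then
      inner q (weight q a b v) (explicit_op q a b v n) (explicit_op q a b v n)
      *m (A m) ^t* *m invmx
      (inner q (weight q a b v) (explicit_op q a b v m) (explicit_op q a b v m)) else 0.
  by rewrite /C; case: (n) => [//|m]; rewrite (HE m.+1) (HE m).
have {}rec z : z *: mxeval (Pt n) z = A n *m mxeval (Pt n.+1) z + B' *m mxeval (Pt n) z
   + C n *m mxeval (Pt n.-1) z.
  by rewrite -evX (PtE n) (PtE n.+1) (PtE n.-1) rec /mxeval !hornerD -!/(mxeval _ _) !evM C_E.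
suff BE : B n = B' by move=> z; rewrite BE.
have uP : mxeval (Pt n) 0 \in unitmx by rewrite unitmxE unitfE gt_eqF.
have := rec 0; rewrite scale0r => /esym/eqP; rewrite addrAC addr_eq0 => /eqP/esym e.
rewrite /B -mulNmx -[RHS](mulmxK uP).
by rewrite -mulmxBl -opprD -e opprK.
Qed.
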